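(* Let $X$ and $Z$ be Hausdorff spaces and $Y$ be a topological vector space such that $Z\subset X\subset Y'_{w^*}$, with continuous injections, where $Y'$ denotes the dual space of $Y$ and $Y'_{w^*}$ is $Y'$ endowed with the weak-star topology. Let $I\subset\mathbb{R}$ be an interval closed and bounded on the left with left end point $t_0$, let $\mathcal{U}$ be a subset of $\mathcal{X}=\mathcal{C}_{\mathrm{loc}}(I,X)$, and let $X_0$ be a Borel subset of $X$. Suppose that (H1') $\Pi_{t_0}\mathcal{U}\supset X_0$; and that there exists a family $\mathfrak{K}'(X_0)$ of compact subsets of $X_0$ such that (H2') every tight Borel probability measure on $X$ which is carried by $X_0$ is inner regular with respect to the family $\mathfrak{K}'(X_0)$; (H3') for every $K\in\mathfrak{K}'(X_0)$, the set $\Pi_{t_0}^{-1}K\cap\mathcal{U}$ is compact in $\mathcal{X}$. Assume, moreover, that the following conditions hold: (H4) $\mathfrak{B}_Z\subset\mathfrak{B}_X$; (H5) $\mathcal{U}\subset\mathcal{X}_1$, and $F:I\times Z\to Y'$ is an $(\mathfrak{L}_I\otimes\mathfrak{B}_Z,\mathfrak{B}_{Y'})$-measurable function such that, for every $u\in\mathcal{U}$, the function $t\mapsto F(t,u(t))$ is weak-star scalarwise locally integrable on $I$ and $\frac{d}{dt}\langle u(t),v\rangle_{Y',Y}=\langle F(t,u(t)),v\rangle_{Y',Y}$ in the distribution sense on $I$, for every $v\in Y$; (H6) there exists a function $\gamma:I\times X\times Y\to\mathbb{R}$ such that, for every $v\in Y$, the function $(t,u)\mapsto\gamma(t,u,v)$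 is $(\mathfrak{L}_I\otimes\mathfrak{B}_X)$-measurable and $$\int_{t_0}^t\left|\langle F(s,u(s)),v\rangle_{Y',Y}\right|\,ds\le\gamma(t,u(t_0),v),\quad\forall t\in I,\ \forall u\in\mathcal{U}.$$ Then, for any tight Borel probability measure $\mu_0$ on $X$ which is carried by $X_0$ and satisfies $$\int_X\gamma(t,u_0,v)\,d\mu_0(u_0)<\infty,\quad\text{for a.e. }t\in I\text{ and for all }v\in Y,$$ there exists a projected statistical solution $\{\rho_t\}_{t\in I}$ of $u_t=F(t,u)$ over $I$, associated with a $\mathcal{U}$-trajectory statistical solution, such that $\rho_{t_0}=\mu_0$.
   Context: $\mathfrak{B}_X$ denotes the Borel $\sigma$-algebra of a topological space $X$; $\mathfrak{L}_I$ the Lebesgue $\sigma$-algebra of the interval $I$. In $\mathfrak{B}_{Y'}$, the dual $Y'$, written without the subscript $w^*$, carries its usual (strong) dual topology, which is the operator-norm topology if $Y$ is a Banach space. Via the continuous injections, $Z$ is regarded as a subset of $X$ and $X$ as a subset of $Y'$; $\mathfrak{B}_Z\subset\mathfrak{B}_X$ means every Borel subset of $Z$ is a Borel subset of $X$. A measure is carried by a measurable set if the complement of the set is null. A Borel measure $\mu$ on $X$ is inner regular with respect to a family $\mathfrak{F}\subset\mathfrak{B}_X$ if $\mu(A)=\sup\{\mu(F):F\in\mathfrak{F},F\subset A\}$ for all $A\in\mathfrak{B}_X$; it is tight if it is nonnegative and inner regular with respect to the compact subsets. $\mathcal{X}=\mathcal{C}_{\mathrm{loc}}(I,X)$ is the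 set of continuous functions $u:I\to X$ with the compact-open topology (subbase $\{u:u(J)\subset O\}$, $J\subset I$ compact subinterval, $O\subset X$ open). $\Pi_tu=u(t)$ and $\Pi_t\rho$ is the push-forward of $\rho$ by $\Pi_t$. A $\mathcal{U}$-trajectory statistical solution over $I$ is a tight Borel probability measure $\rho$ on $\mathcal{X}$ for which there is $\mathcal{V}\in\mathfrak{B}_{\mathcal{X}}$ with $\mathcal{V}\subset\mathcal{U}$ and $\rho(\mathcal{X}\setminus\mathcal{V})=0$. A function $w:I\to Y'$ has a property weak-star scalarwise if $t\mapsto\langle w(t),v\rangle_{Y',Y}$ has the property for every $v\in Y$ (for locally integrable: Lebesgue integrable on compact subsets of $I$). ''Absolutely continuous on $I$'' means absolutely continuous on every compact subinterval of $I$. $\mathcal{Y}_1$ is the set of $u:I\to Y'$ that are weak-star scalarwise absolutely continuous and for which there is a weak-star scalarwise locally integrable $w:I\to Y'$ with $\frac{d}{dt}\langle u(t),v\rangle_{Y',Y}=\langle w(t),v\rangle_{Y',Y}$ for a.e. $t\in I$, for every $v\in Y$. Further, $\mathcal{Z}=\{u\in\mathcal{X}:u(t)\in Z\text{ for a.e. }t\in I\}$ and $\mathcal{X}_1=\mathcal{Z}\cap\mathcal{Y}_1$. For $u\in\mathcal{X}_1$, $F(t,u(t))$ is defined for a.e. $t$. Distributions on $I$ are tested against $\mathcal{C}^\infty_c(I)$, the smooth functions compactly supported in the interior of $I$. $L^1_{\mathrm{loc}}(I)$ means integrable on compact subsets of $I$. A cylindrical test function in $Y'$ is a function $\Phi(u)=\phi(\langle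 u,v_1\rangle_{Y',Y},\dots,\langle u,v_k\rangle_{Y',Y})$, $u\in Y'$, with $k\in\mathbb{N}$, $v_1,\dots,v_k\in Y$ and $\phi:\mathbb{R}^k\to\mathbb{R}$ continuously differentiable with compact support; its differential is $\Phi'(u)=\sum_{j=1}^k\partial_j\phi(\langle u,v_1\rangle_{Y',Y},\dots,\langle u,v_k\rangle_{Y',Y})\,v_j\in Y$. A statistical solution in phase space of $u_t=F(t,u)$ over $I$ is a family $\{\rho_t\}_{t\in I}$ of Borel probability measures on $X$ such that: (i) $t\mapsto\int_X\varphi\,d\rho_t$ is continuous on $I$ for every bounded continuous $\varphi:X\to\mathbb{R}$; (ii) for almost every $t\in I$, the measure $\rho_t$ is carried by $Z$ and the function $u\mapsto\langle F(t,u),v\rangle_{Y',Y}$ is $\rho_t$-integrable, for every $v\in Y$; moreover, the map $t\mapsto\int_X\langle F(t,u),v\rangle_{Y',Y}\,d\rho_t(u)$ belongs to $L^1_{\mathrm{loc}}(I)$, for every $v\in Y$; (iii) for every cylindrical test function $\Phi$ in $Y'$ and all $t,t'\in I$, $\int_X\Phi\,d\rho_t=\int_X\Phi\,d\rho_{t'}+\int_{t'}^t\int_X\langle F(s,u),\Phi'(u)\rangle_{Y',Y}\,d\rho_s(u)\,ds$. A projected statistical solution of $u_t=F(t,u)$ over $I$, associated with a $\mathcal{U}$-trajectory statistical solution, is a statistical solution in phase space $\{\rho_t\}_{t\in I}$ for which there exists a $\mathcal{U}$-trajectory statistical solution $\rho$ with $\rho_t=\Pi_t\rho$ for every $t\in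 I$.
   Formalization: If I has a largest element T > t_0, finiteness of the integral of γ(T,u_0,v) against μ_0 for all v is also assumed (the claim fails on [t_0,T] otherwise); in (ii) the null set of times t may depend on v (a common null set for all v fails in general). *)

(* Defs.v *)
From HB Require Import structures.
From mathcomp Require Import all_boot all_order all_algebra.
From mathcomp Require Import all_classical all_reals all_analysis.

Set Implicit Arguments.
Unset Strict Implicit.
Unset Printing Implicit Defensive.

Import Order.TTheory GRing.Theory Num.Theory.
Import numFieldNormedType.Exports.

Local Open Scope classical_set_scope.
Local Open Scope ring_scope.

(* [measurableType] requires a point, whence the pointed topological spaces. *)
Notation borel T := (g_sigma_algebraType (@open T)).

Section borel_measures.
Context {R : realType} {T : ptopologicalType}.
Implicit Types mu : probability (borel T) R.

(* The supremum is taken in [0, +oo]: it is 0 when no member of [FF] is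
   contained in [A]. *)
Definition inner_regular mu (FF : set (set T)) :=
  forall A : set (borel T), measurable A ->
    mu A = ereal_sup ([set 0%E] `|` [set mu K | K in [set K | FF K /\ K `<=` A]]).

Definition tight mu := inner_regular mu (@compact T).

Definition carried_by mu (A : set (borel T)) := measurable A /\ mu (~` A) = 0%E.

End borel_measures.

(* An interval closed and bounded on the left, as a set with a least element:
   [t0, t1], [t0, t1[ or [t0, +oo[. *)
Record left_closed_itv (R : realType) := LeftClosedItv {
  itv_set :> set R ;
  itv_left : R ;
  itv_setP : is_interval itv_set ;
  itv_leftP : itv_set itv_left ;
  itv_left_le : forall t, itv_set t -> itv_left <= t }.

Definition time (R : realType) (I : left_closed_itv R) : Type :=
  set_type (itv_set I).

Section time.
Context {R : realType} (I : left_closed_itv R).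

HB.instance Definition _ := Topological.copy (time I) (set_type (itv_set I)).

Definition time_val (t : time I) : R := set_val t.

Definition time_min : time I := SigSub (mem_set (itv_leftP I)).

HB.instance Definition _ := isPointed.Build (time I) time_min.

Let leb_set (A : set (time I)) : set R := time_val @` A.

(* The Lebesgue sigma-algebra of I: the subsets of I that are Lebesgue
   measurable as subsets of R. *)
Definition lebesgue_measurable_time (A : set (time I)) :=
  (wlength (R := R) idfun)^*%mu.-cara.-measurable (leb_set A).

Let time_val_inj : injective time_val.
Proof. by move=> s t /val_inj. Qed.

Let leb_measurable0 : lebesgue_measurable_time set0.
Proof. by rewrite /lebesgue_measurable_time /leb_set image_set0. Qed.

Let leb_setC A : leb_set (~` A) = itv_set I `\` leb_set A.
Proof.
apply/seteqP; split => [_ [t nAt <-]|x [Ix nAx]].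
  by split; [exact: set_valP|move=> [s As /time_val_inj st]; apply: nAt; rewrite -st].
exists (SigSub (mem_set Ix)) => // Ax; apply: nAx.
by exists (SigSub (mem_set Ix)).
Qed.

Let leb_measurableC A : lebesgue_measurable_time A ->
  lebesgue_measurable_time (~` A).
Proof.
move=> mA; rewrite /lebesgue_measurable_time leb_setC.
apply: measurableD => //; apply: sub_caratheodory.
by have /is_intervalP -> := @itv_setP _ I; exact: measurable_itv.
Qed.

Let leb_bigcup (F : (set (time I))^nat) :
  leb_set (\bigcup_i F i) = \bigcup_i leb_set (F i).
Proof. by rewrite /leb_set image_bigcup. Qed.

Let leb_measurable_bigcup (F : (set (time I))^nat) :
  (forall i, lebesgue_measurable_time (F i)) ->
  lebesgue_measurable_time (\bigcup_i F i).
Proof.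
move=> mF; rewrite /lebesgue_measurable_time leb_bigcup.
by apply: bigcupT_measurable => i; exact: mF.
Qed.

HB.instance Definition _ := @isMeasurable.Build default_measure_display
  (time I) lebesgue_measurable_time leb_measurable0 leb_measurableC
  leb_measurable_bigcup.

Definition lebesgue_time (A : set (time I)) : \bar R :=
  completed_lebesgue_measure (leb_set A).

Let lebesgue_time0 : lebesgue_time set0 = 0%E.
Proof. by rewrite /lebesgue_time /leb_set image_set0 measure0. Qed.

Let lebesgue_time_ge0 A : (0 <= lebesgue_time A)%E.
Proof. exact: measure_ge0. Qed.

Let lebesgue_time_sigma_additive : semi_sigma_additive lebesgue_time.
Proof.
move=> F mF tF mUF; rewrite /lebesgue_time leb_bigcup.
apply: measure_semi_sigma_additive => //.
- apply/trivIsetP => i j _ _ ij; rewrite -subset0 => x [[s Fis <-]].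
  move=> [r Fjr /time_val_inj rs]; rewrite rs in Fjr.
  have /trivIsetP/(_ i j Logic.I Logic.I ij) := tF.
  by rewrite -subset0 => /(_ s); apply.
- by have := mUF; rewrite /measurable/= /lebesgue_measurable_time leb_bigcup.
Qed.

HB.instance Definition _ := isMeasure.Build _ _ _ lebesgue_time
  lebesgue_time0 lebesgue_time_ge0 lebesgue_time_sigma_additive.

End time.

Arguments lebesgue_time {R} I A.
Arguments time_min {R} I.

Record topdual (R : realType) (Y : topologicalLmodType R) := TopDual {
  dual_fun :> {scalar Y} ;
  dual_continuous : continuous (dual_fun : Y -> R) }.

Section dual.
Context {R : realType} {Y : topologicalLmodType R}.

HB.instance Definition _ := gen_eqMixin (topdual Y).
HB.instance Definition _ := gen_choiceMixin (topdual Y).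

Let dual0_continuous : continuous (\0 : Y -> R).
Proof. by move=> y; exact: cvg_cst. Qed.

HB.instance Definition _ := isPointed.Build (topdual Y) (TopDual dual0_continuous).

(* von Neumann boundedness *)
Definition tvs_bounded (B : set Y) :=
  forall V : set Y, nbhs 0 V ->
    exists r : R, forall a : R, r <= `|a| -> B `<=` [set a *: y | y in V].

End dual.

Definition weak_star (R : realType) (Y : topologicalLmodType R) : Type := topdual Y.
Definition strong_dual (R : realType) (Y : topologicalLmodType R) : Type := topdual Y.

Section dual_topologies.
Context {R : realType} (Y : topologicalLmodType R).

HB.instance Definition _ := Pointed.copy (weak_star Y) (topdual Y).
HB.instance Definition _ := Topological.copy (weak_star Y)
  (initial_topology (fun f : topdual Y => (f : Y -> R) : {ptws Y -> R})).

HB.instance Definition _ := Pointed.copy (strong_dual Y) (topdual Y).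
HB.instance Definition _ := Topological.copy (strong_dual Y)
  (initial_topology
     (fun f : topdual Y => (f : Y -> R) : {family @tvs_bounded R Y, Y -> R})).

End dual_topologies.

(* X need not be uniform, so the topology is the compact-open one, tested on all
   compact subsets of I; as each point of I has a basis of neighbourhoods that
   are compact intervals, compact subintervals give the same topology. *)
Definition paths (R : realType) (I : left_closed_itv R) (X : topologicalType)
  : Type := continuousType (time I) X.

HB.instance Definition _ (R : realType) (I : left_closed_itv R)
    (X : ptopologicalType) :=
  Choice.copy (paths I X) (continuousType (time I) X).
HB.instance Definition _ (R : realType) (I : left_closed_itv R)
    (X : ptopologicalType) :=
  isPointed.Build (paths I X) (cst point : continuousType (time I) X).
HB.instance Definition _ (R : realType) (I : left_closed_itv R)
    (X : ptopologicalType) :=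
  Topological.copy (paths I X)
    (initial_topology
       (fun u : paths I X => (u : time I -> X) : {compact-open, time I -> X})).

Section time_functions.
Context {R : realType} {I : left_closed_itv R}.
Implicit Types f g : time I -> R.

Definition time_segment (a b : time I) : set (time I) :=
  [set s | time_val a <= time_val s <= time_val b].

Definition time_integral (a b : time I) f : R :=
  if time_val a <= time_val b then \int[lebesgue_time I]_(s in time_segment a b) f s
  else - \int[lebesgue_time I]_(s in time_segment b a) f s.

Definition loc_integrable f :=
  forall K : set (time I), compact K ->
    (lebesgue_time I).-integrable K (EFin \o f).

Definition abs_continuous_on (a b : time I) f :=
  forall e : R, 0 < e -> exists2 d : R, 0 < d &
    forall (n : nat) (x y : 'I_n -> time I),
      (forall i, time_segment a b (x i) /\ time_segment a b (y i) /\
                 time_val (x i) <= time_val (y i)) ->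
      (forall i j, i != j ->
         time_val (y i) <= time_val (x j) \/ time_val (y j) <= time_val (x i)) ->
      \sum_i (time_val (y i) - time_val (x i)) < d ->
      \sum_i `|f (y i) - f (x i)| < e.

Definition loc_abs_continuous f := forall a b : time I, abs_continuous_on a b f.

Definition has_time_derivative f (t : time I) (l : R) :=
  (f s - f t) / (time_val s - time_val t) @[s --> t^'] --> l.

Definition test_function (theta : R -> R) :=
  [/\ forall n x, derivable (derive1n n theta) x 1,
      compact (closure [set x | theta x != 0]) &
      closure [set x | theta x != 0] `<=` (itv_set I)°].

Definition distr_derivative f g :=
  forall theta : R -> R, test_function theta ->
    \int[lebesgue_time I]_t (f t * derive1 theta (time_val t)) =
    - \int[lebesgue_time I]_t (g t * theta (time_val t)).

End time_functions.

Definition Y1 (R : realType) (I : left_closed_itv R) (Y : topologicalLmodType R)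
    (u : time I -> topdual Y) :=
  (forall v, loc_abs_continuous (fun t => u t v)) /\
  exists w : time I -> topdual Y,
    (forall v, loc_integrable (fun t => w t v)) /\
    (forall v, \forall t \ae lebesgue_time I,
       has_time_derivative (fun s => u s v) t (w t v)).

Section cylindrical.
Context {R : realType} {Y : topologicalLmodType R} {k : nat}.
Implicit Types (phi : 'rV[R]_k -> R) (v : 'I_k -> Y).

Definition C1c phi :=
  [/\ forall x, differentiable phi x,
      forall h, continuous (fun x => 'D_h phi x) &
      compact (closure [set x | phi x != 0])].

Definition coords v (u : topdual Y) : 'rV[R]_k := \row_j u (v j).

Definition cylinder phi v (u : topdual Y) : R := phi (coords v u).

Definition cylinder' phi v (u : topdual Y) : Y :=
  \sum_j ('D_(delta_mx 0 j) phi (coords v u)) *: v j.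

End cylindrical.

Section evolution_equation.
Context {R : realType} (I : left_closed_itv R) (X Z : ptopologicalType)
        (Y : topologicalLmodType R).
(* the injections of Z into X and of X into the weak-star dual of Y *)
Variables (iZX : Z -> X) (iXY : X -> weak_star Y).
Variable F : time I * Z -> topdual Y.

Definition inZ : set X := range iZX.

(* [pairF t x v] is <F(t,x),v> for x in Z, extended by 0 to the whole of X. *)
Definition pairF (t : time I) (x : X) (v : Y) : R :=
  ((fun x => F (t, get [set z | iZX z = x]) v : R) \_ inZ) x.

Definition X1 : set (paths I X) :=
  [set u | (\forall t \ae lebesgue_time I, inZ (u t)) /\
           Y1 (fun t => iXY (u t) : topdual Y)].

(* In the second clause the null set of times may depend on v. *)
Definition statistical_solution
    (rho : time I -> probability (borel X) R) : Prop :=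
  [/\
    (forall phi : X -> R, continuous phi ->
       (exists M, forall x, `|phi x| <= M) ->
       continuous (fun t => \int[rho t]_x phi x)),
    (forall v : Y,
       (\forall t \ae lebesgue_time I,
          carried_by (rho t) inZ /\
          (rho t).-integrable setT (fun x => (pairF t x v)%:E)) /\
       loc_integrable (fun t => \int[rho t]_x pairF t x v)) &
    (forall (k : nat) (phi : 'rV[R]_k -> R) (v : 'I_k -> Y), C1c phi ->
       (* the time integral below exists as a Lebesgue integral *)
       loc_integrable
         (fun s => \int[rho s]_x pairF s x (cylinder' phi v (iXY x))) /\
       forall t t' : time I,
         \int[rho t]_x cylinder phi v (iXY x) =
         \int[rho t']_x cylinder phi v (iXY x) +
         time_integral t' t
           (fun s => \int[rho s]_x pairF s x (cylinder' phi v (iXY x))))].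

End evolution_equation.

Section trajectory.
Context {R : realType} (I : left_closed_itv R) (X : ptopologicalType).

Definition eval_at (t : time I) (u : paths I X) : X := u t.

Definition trajectory_statistical_solution (U : set (paths I X))
    (rho : probability (borel (paths I X)) R) : Prop :=
  tight rho /\
  exists V : set (borel (paths I X)),
    [/\ measurable V, V `<=` U & rho (~` V) = 0%E].

End trajectory.

Definition projected_statistical_solution (R : realType)
    (I : left_closed_itv R) (X Z : ptopologicalType)
    (Y : topologicalLmodType R) (iZX : Z -> X) (iXY : X -> weak_star Y)
    (F : time I * Z -> topdual Y) (U : set (paths I X))
    (rho : time I -> probability (borel X) R) : Prop :=
  statistical_solution iZX iXY F rho /\
  exists P : probability (borel (paths I X)) R,
    trajectory_statistical_solution U P /\
    forall (t : time I) (A : set (borel X)), measurable A ->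
      rho t A = pushforward P (eval_at t : borel (paths I X) -> borel X) A.

(* Main.v *)
(* The initial measure is lifted to trajectories without any disintegration:
   extend [mu0] to a finitely additive measure on all subsets of X, push it
   forward by an arbitrary right inverse X0 -> U of the evaluation at t0, and
   turn the result into a tight Borel measure P through the content
   K |-> inf of the masses of the open sets containing the compact K.  The
   sets Pi_{t0}^-1 K /\ U with K in K'(X0) are compact, so they lose no mass;
   hence P is a probability carried by U, and Pi_{t0} P >= mu0, which for
   probabilities is an equality.

   For a single trajectory u in U, testing the equation against smooth plateau
   functions gives <u(b) - u(a), v> = int_a^b <F(s, u(s)), v> ds, and comparing
   increments of Phi o u on short intervals gives the chain rule for a
   cylindrical Phi.  Integrating this identity against P and exchanging the two
   integrals is the claim; Fubini's theorem applies by the bound (H6). *)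

Require Import Defs.
From HB Require Import structures.
From mathcomp Require Import all_boot all_order all_algebra.
From mathcomp Require Import all_classical all_reals all_analysis.
From mathcomp Require Import measurable_realfun ring lra.

Set Implicit Arguments.
Unset Strict Implicit.
Unset Printing Implicit Defensive.

Import Order.TTheory GRing.Theory Num.Theory.
Import numFieldNormedType.Exports.

Local Open Scope classical_set_scope.
Local Open Scope ring_scope.

(** * Finitely additive extensions *)

(** The right inverse of the evaluation need not be measurable, and [U] is an arbitrary set of
    paths, so [mu0] itself cannot be pushed forward; a functional defined on all subsets can, at the
    price of countable additivity. Compactness restores the latter: the content is tested on compact
    sets only, for which a countable open cover is a finite one. What survives the construction is
    one inequality, [nu K <= P K] for compact [K]. It suffices because the inner regularity of [mu0]
    with respect to the distinguished family involves only compact sets whose lifts to [U] are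
    compact again. Neither [X] nor the path space is assumed metrizable or second countable.
    Sequences and countable covers are therefore always taken in the time variable, as for the joint
    measurability of evaluation and for the continuity in time of the integrals. The vector field
    along a trajectory is only locally integrable. In the chain rule the error on a short interval
    is therefore measured by the integral of the field over that interval, not by its length. *)

Definition finitely_additive (R : numDomainType) (T : Type) (nu : set T -> R) :=
  (forall A, 0 <= nu A) /\
  forall A B, A `&` B = set0 -> nu (A `|` B) = nu A + nu B.

Lemma finitely_additive_le (R : numDomainType) (T : Type)
    (nu : set T -> R) A B :
  finitely_additive nu -> A `<=` B -> nu A <= nu B.
Proof.
move=> [nu0 nuU] AB; rewrite -(setDUK AB) nuU ?lerDl ?setDIK//.
Qed.

Lemma finitely_additiveU (R : numDomainType) (T : Type) (nu : set T -> R) A B :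
  finitely_additive nu -> nu (A `|` B) <= nu A + nu B.
Proof.
move=> nuA; have -> : A `|` B = A `|` (B `\` A).
  by apply/seteqP; split => x [Ax|]; [left| |left|case; right] => //;
    have [|] := pselect (A x); [left|right].
rewrite (nuA.2 _ _ _); last exact: setDIK.
rewrite lerD2l; apply: finitely_additive_le => //; exact: subDsetl.
Qed.

(* The list cuts [D] into finitely many cells, and [nu] concentrates the mass of
   each cell in one of its points. *)
Lemma finite_list_extension d (T : measurableType d) (R : realType)
    (mu : {finite_measure set T -> \bar R}) (s : seq (set T)) (D : set T) :
  measurable D ->
  exists nu : set T -> R, [/\ finitely_additive nu, nu D = fine (mu D),
    forall A, nu A = nu (A `&` D) &
    forall E, E \in s -> measurable E -> nu (E `&` D) = fine (mu (E `&` D))].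
Proof.
elim: s D => [|E s IH] D mD.
  have [->|/set0P[x Dx]] := eqVneq D set0.
    exists (fun=> 0); rewrite measure0; split => //; split => // A B _.
    by rewrite addr0.
  exists (fun A => fine (mu D) * (\1_A x)); split => //.
  - split=> [A|A B AB]; first by rewrite mulr_ge0// fine_ge0.
    rewrite -mulrDr !indicE in_setU; congr *%R.
    have [Ax|] := boolP (x \in A); last by rewrite add0r.
    have [Bx|] := boolP (x \in B); last by rewrite addr0.
    by have := in_set0 x; rewrite -AB in_setI Ax Bx.
  - by rewrite indicE mem_set ?mulr1.
  - by move=> A; rewrite !indicE in_setI (mem_set Dx) andbT.
have [mE|nmE] := pselect (measurable E); last first.
  have [nu [? ? ? H]] := IH D mD; exists nu; split => // E'.
  by rewrite inE => /orP[/eqP->//|]; exact: H.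
have mDE : measurable (E `&` D) by exact: measurableI.
have mDE' : measurable (~` E `&` D) by apply: measurableI => //;
  exact: measurableC.
(* Each half of the cell gets its own functional. By the third clause the functional of one half
   vanishes on the other, so the sum has the right value on [E] and on the remaining sets of the
   list. *)
have [nu1 [[p1 a1] d1 r1 e1]] := IH _ mDE.
have [nu2 [[p2 a2] d2 r2 e2]] := IH _ mDE'.
have split A : measurable A ->
    fine (mu (A `&` D)) = fine (mu (A `&` (E `&` D))) + fine (mu (A `&` (~` E
      `&` D))).
  move=> mA; rewrite -fineD ?fin_num_measure//; try exact: measurableI.
  rewrite -measureU//; try exact: measurableI.
    by congr (fine (mu _)); rewrite -setIUr -setIUl setUv setTI.
  by apply/seteqP; split => // x [[_ [Ex _]] [_ [nEx _]]].
have z1 : nu1 (~` E `&` D) = 0.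
  rewrite r1 (_ : _ `&` _ = set0); last first.
    by apply/seteqP; split => // x [[nEx _] [Ex _]].
  by have := a1 set0 set0 (setI0 _); rewrite setU0; lra.
have z2 : nu2 (E `&` D) = 0.
  rewrite r2 (_ : _ `&` _ = set0); last first.
    by apply/seteqP; split => // x [[nEx _] [Ex _]].
  by have := a2 set0 set0 (setI0 _); rewrite setU0; lra.
exists (fun A => nu1 A + nu2 A); split.
- split=> [A|A B AB]; first by rewrite addr_ge0.
  by rewrite a1// a2// addrACA.
- rewrite r1 (r2 D) !setIA.
  rewrite ![D `&` _]setIC -!setIA setIid d1 d2.
  by have := split setT measurableT; rewrite !setTI => ->.
- move=> A; rewrite [RHS]/= [in LHS]r1 [in LHS]r2 [in RHS]r1 [in RHS]r2.
  by rewrite -!setIA ![D `&` (_ `&` D)]setICA !setIid.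
- move=> E'; rewrite inE => /orP[/eqP -> _|E's mE'].
    rewrite z2 addr0 d1 => //.
  rewrite split// -e1// -e2// [in LHS]r1 [in LHS]r2.
  by rewrite -!setIA ![D `&` (_ `&` D)]setICA !setIid.
Qed.

(* A limit, along an ultrafilter on the finite lists of sets ordered by
   inclusion, of the measures of [finite_list_extension]. *)
Lemma finitely_additive_extension d (T : measurableType d) (R : realType)
    (mu : {finite_measure set T -> \bar R}) :
  exists2 nu : set T -> R, finitely_additive nu &
    forall A, measurable A -> nu A = fine (mu A).
Proof.
have /choice[g gP] : forall s : seq (set T), exists nu : set T -> R,
    [/\ finitely_additive nu, nu setT = fine (mu setT) &
     forall E, E \in s -> measurable E -> nu E = fine (mu E)].
  move=> s; have [nu [h1 h2 h3 h4]] := finite_list_extension mu s measurableT.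
  exists nu; split => // E Es mE; have := h4 E Es mE.
  by rewrite setIT.
(* The sets that contain all lists beyond some list; [s ++ s'] is a common upper bound, so they form
   a filter. *)
pose G := [set A : set (seq (set T)) |
  exists s : seq (set T), forall s', {subset s <= s'} -> A s'].
have GF : ProperFilter G.
  split; first by move=> [s /(_ s)]; apply.
  split; first by exists [::].
  - move=> A B [s As] [s' Bs']; exists (s ++ s') => s'' ss; split.
      by apply: As => x xs; apply: ss; rewrite mem_cat xs.
    by apply: Bs' => x xs; apply: ss; rewrite mem_cat xs orbT.
  - by move=> A B AB [s As]; exists s => s' /As /AB.
have [H [HU GH]] := ultraFilterLemma GF.
have HP : ProperFilter H := ultra_proper.
have /choice[nu nuP] : forall A, exists p : R, (fun s => g s A) @ H --> p.
  move=> A.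
  have cK := @segment_compact R 0 (fine (mu setT)).
  have gK s : g s A \in `[0, fine (mu setT)].
    have [[g0 gU] gT _] := gP s.
    by rewrite in_itv/= g0 -gT/=; apply: finitely_additive_le.
  (* The values lie in a compact segment, so they cluster at some point; along an ultrafilter a
     cluster point is a limit. *)
  have := cK ((fun s => g s A) @ H) _ _.
  case => //; first by apply: nearW => s; exact: gK.
  move=> p [_ clp]; exists p => V Vp.
  have [//|nV] := in_ultra_setVsetC ((fun s => g s A) @^-1` V) HU.
  by have [y [nVy Vy]] := clp (~` V) V nV Vp.
exists nu.
  split=> [A|A B AB].
    by apply: (cvgr_to_ge (nuP A)); apply: nearW => s; have [[]] := gP s.
  have : (fun s => g s (A `|` B)) @ H --> nu A + nu B.
    have -> : (fun s => g s (A `|` B)) = (fun s => g s A) \+ (fun s => g s B).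
      by apply/funext => s /=; have [[_ ->]] := gP s.
    exact: cvgD (nuP A) (nuP B).
  by apply: (cvg_unique (@Rhausdorff R)); exact: nuP.
move=> A mA.
(* The values are constant as soon as the list contains [A]. *)
have muA : (fun s => g s A) @ H --> fine (mu A).
  apply: cvg_near_cst; apply: GH; exists [:: A] => s As.
  have [_ _] := gP s; apply => //; apply: As; exact: mem_head.
exact: (cvg_unique (@Rhausdorff R) (nuP A)).
Qed.

(** * Tight measures from contents *)

Section compact_sets.
Context {T : ptopologicalType}.
Implicit Types (K L G H : set T).

(** Finite subcovers are extracted here once and for all: with a suitable [P] this gives the
    separation of disjoint compact sets, the countable subadditivity of [inner_content] and the
    boundedness of compact sets of times. *)
Lemma compact_open_ind (P : set T -> Prop) K : compact K ->
  P set0 -> (forall A B, P A -> P B -> P (A `|` B)) ->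
  (forall x, K x -> exists U, [/\ open U, U x & P U]) ->
  exists U, [/\ open U, K `<=` U & P U].
Proof.
move=> cK P0 PU locP.
have /choice[f fP] : forall x, exists U, K x -> [/\ open U, U x & P U].
  move=> x; have [Kx|nKx] := pselect (K x); last by exists set0.
  by have [U UP] := locP x Kx; exists U.
move: cK; rewrite compact_cover => /(_ T K f) [].
- by move=> x /fP[].
- by move=> x Kx; exists x => //; have [] := fP x Kx.
move=> D' D'K; rewrite /cover bigcup_fset => KD.
exists (\big[setU/set0]_(i <- finmap.enum_fset D') f i).
have D'f i : i \in finmap.enum_fset D' -> [/\ open (f i), f i i & P (f i)].
  by move=> iD'; apply: fP; have := D'K _ iD'; rewrite inE.
split=> //; rewrite big_seq; elim/big_ind: _ => //.
- exact: open0.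
- by move=> A B; exact: openU.
- by move=> i /D'f[].
- by move=> i /D'f[].
Qed.

Hypothesis hT : hausdorff_space T.

(** Two passes of [compact_open_ind]: over [L], to separate it from a single point, then over [K].
    Intersecting the finitely many opposite neighbourhoods keeps them open. *)
Lemma hausdorff_compact_separated K L : compact K -> compact L ->
  K `&` L = set0 ->
  exists U V, [/\ open U, open V, K `<=` U, L `<=` V & U `&` V = set0].
Proof.
move=> cK cL KL0.
have sepx x : ~ L x -> exists U V,
    [/\ open U, U x, open V, L `<=` V & U `&` V = set0].
  move=> nLx.
  have [|||V [oV LV [U [oU Ux UV]]]] := compact_open_ind
    (P := fun V => exists U, [/\ open U, U x & U `&` V = set0]) cL.
  - by exists setT; split => //; [exact: openT|rewrite setI0].
  - move=> A B [U [oU Ux UA]] [V [oV Vx VB]]; exists (U `&` V); split => //.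
      exact: openI.
    by rewrite setIUr setIAC UA set0I set0U -setIA VB setI0.
  - move=> y Ly; have /eqP xy : x <> y by move=> xy; apply: nLx; rewrite xy.
    move: (hT); rewrite open_hausdorff => /(_ x y xy)[[A B]]/= [].
    rewrite !inE => Ax By [oA oB AB].
    by exists B; split => //; exists A; split => //; exact/eqP.
  by exists U, V.
have [|||U [oU KU [V [oV LV UV]]]] := compact_open_ind
  (P := fun U => exists V, [/\ open V, L `<=` V & U `&` V = set0]) cK.
- by exists setT; split => //; [exact: openT|rewrite set0I].
- move=> A B [U [oU Ux UA]] [V [oV Vx VB]]; exists (U `&` V); split => //.
  + exact: openI.
  + by rewrite subsetI.
  + by rewrite setIUl setIA UA set0I set0U setIC -setIA [_ `&` B]setIC VB setI0.
- move=> x Kx; have nLx : ~ L x.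
    by move=> Lx; have : (K `&` L) x by []; rewrite KL0.
  by have [U [V [? ? ? ? ?]]] := sepx x nLx; exists U; split => //; exists V.
by exists U, V.
Qed.

Lemma compactDopen K G : compact K -> open G -> compact (K `\` G).
Proof.
move=> cK oG; apply: (subclosed_compact _ cK) => //.
by apply: closedI; [exact: compact_closed|exact: open_closedC].
Qed.

(** The compact sets [K \ G] and [K \ H] are disjoint because [G] and [H] cover [K]. Removing from
    [K] one or the other of two disjoint open sets around them gives the two pieces. *)
Lemma compact_split K G H : compact K -> open G -> open H -> K `<=` G `|` H ->
  exists K1 K2, [/\ compact K1, compact K2, K1 `<=` G, K2 `<=` H &
                    K = K1 `|` K2].
Proof.
move=> cK oG oH KGH.
have [|U [V [oU oV KU KV UV0]]] :=
  @hausdorff_compact_separated (K `\` G) (K `\` H)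
  (compactDopen cK oG) (compactDopen cK oH).
  by apply/seteqP; split => // x [[/KGH[] Gx nGx [_ nHx]]].
exists (K `\` U), (K `\` V); split; try exact: compactDopen.
- by move=> x [Kx nUx]; apply: contrapT => nGx; apply: nUx; exact: KU.
- by move=> x [Kx nVx]; apply: contrapT => nHx; apply: nVx; exact: KV.
- by rewrite -setDIr UV0 setD0.
Qed.

End compact_sets.

Section content.
Context {R : realType} {T : ptopologicalType}.
Hypothesis hT : hausdorff_space T.
Variable nu : set T -> R.
Hypothesis nu_add : finitely_additive nu.
Hypothesis nuT : nu setT = 1.

Local Open Scope ereal_scope.

(* Halmos' construction, with [content] used on the compact sets,
   [inner_content] on the open sets and [outer_content] on all sets. *)
Definition content (K : set T) : \bar R :=
  ereal_inf [set (nu G)%:E | G in [set G | open G /\ K `<=` G]].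

Definition inner_content (G : set T) : \bar R :=
  ereal_sup [set content K | K in [set K | compact K /\ K `<=` G]].

Definition outer_content (E : set T) : \bar R :=
  ereal_inf [set inner_content G | G in [set G | open G /\ E `<=` G]].

Let nu_le A B : A `<=` B -> (nu A <= nu B)%R.
Proof. exact: finitely_additive_le. Qed.

Let nuU A B : (nu (A `|` B) <= nu A + nu B)%R.
Proof. exact: finitely_additiveU. Qed.

Let content_lb K : (nu K)%:E <= content K.
Proof.
by apply: le_ereal_inf_tmp => _ [G [oG KG] <-]; rewrite lee_fin nu_le.
Qed.

Let content_ub K G : open G -> K `<=` G -> content K <= (nu G)%:E.
Proof. by move=> oG KG; apply: ereal_inf_lbound; exists G. Qed.

Let content_ge0 K : 0 <= content K.
Proof. by rewrite (le_trans _ (content_lb K))// lee_fin nu_add.1. Qed.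

Let content_le1 K : content K <= 1.
Proof. by rewrite (le_trans (content_ub openT _))// nuT. Qed.

Let content_fin K : content K \is a fin_num.
Proof.
by rewrite ge0_fin_numE// (le_lt_trans (content_le1 K))// ltry.
Qed.

Let content_adh K (e : R) : (0 < e)%R ->
  exists G, [/\ open G, K `<=` G & (nu G)%:E <= content K + e%:E].
Proof.
move=> e0; have [_ [G [oG KG] <-] /ltW ?] :=
  lb_ereal_inf_adherent e0 (content_fin K).
by exists G.
Qed.

Let contentU K L : content (K `|` L) <= content K + content L.
Proof.
apply/lee_addgt0Pr => e e0.
have e20 : (0 < e / 2)%R by rewrite divr_gt0.
have [G [oG KG nG]] := content_adh K e20.
have [H [oH LH nH]] := content_adh L e20.
have -> : e%:E = (e / 2)%:E + (e / 2)%:E by rewrite -EFinD -splitr.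
rewrite addeACA (le_trans _ (leeD nG nH))// -EFinD.
apply: (@le_trans _ _ (nu (G `|` H))%:E); last by rewrite lee_fin.
by apply: content_ub; [exact: openU|exact: setUSS].
Qed.

(** Disjoint open neighbourhoods [U] and [V] cut a nearly optimal open set [G] into two disjoint
    parts, on which [nu] is additive. For arbitrary disjoint sets this may fail. *)
Let contentU_disj K L : compact K -> compact L -> K `&` L = set0 ->
  content K + content L <= content (K `|` L).
Proof.
move=> cK cL KL0; apply/lee_addgt0Pr => e e0.
have [U [V [oU oV KU LV UV0]]] := hausdorff_compact_separated hT cK cL KL0.
have [G [oG KLG nG]] := content_adh (K `|` L) e0.
rewrite (le_trans _ nG)// (@le_trans _ _ ((nu (G `&` U))%:E + (nu (G `&`
  V))%:E))//.
  apply: leeD; apply: content_ub; try exact: openI.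
  - by move=> x Kx; split; [apply: KLG; left|exact: KU].
  - by move=> x Lx; split; [apply: KLG; right|exact: LV].
rewrite -EFinD lee_fin -nu_add.2; first by apply: nu_le => x [[]|[]].
by rewrite setIACA UV0 setI0.
Qed.

Let inner_ub K G : compact K -> K `<=` G -> content K <= inner_content G.
Proof. by move=> cK KG; apply: ereal_sup_ubound; exists K. Qed.

Let inner_le G (x : \bar R) :
  (forall K, compact K -> K `<=` G -> content K <= x) -> inner_content G <= x.
Proof. by move=> H; apply: ge_ereal_sup => _ [K [cK KG] <-]; exact: H. Qed.

Let inner_nu G : open G -> inner_content G <= (nu G)%:E.
Proof. by move=> oG; apply: inner_le => K cK; exact: content_ub. Qed.

Let inner_ge0 G : 0 <= inner_content G.
Proof. by rewrite (le_trans (content_ge0 set0))// inner_ub//;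
  exact: compact0. Qed.

Let inner_fin G : inner_content G \is a fin_num.
Proof.
rewrite ge0_fin_numE// (@le_lt_trans _ _ 1) ?ltry//.
by apply: inner_le => K _ _; exact: content_le1.
Qed.

Let le_inner G H : G `<=` H -> inner_content G <= inner_content H.
Proof.
by move=> GH; apply: inner_le => K cK KG; apply: inner_ub => //;
  exact: subset_trans GH.
Qed.

Let innerU G H : open G -> open H ->
  inner_content (G `|` H) <= inner_content G + inner_content H.
Proof.
move=> oG oH; apply: inner_le => K cK KGH.
have [K1 [K2 [cK1 cK2 K1G K2H ->]]] := compact_split hT cK oG oH KGH.
by rewrite (le_trans (contentU _ _))// leeD// inner_ub.
Qed.

Let inner_adh G (e : R) : (0 < e)%R ->
  exists K, [/\ compact K, K `<=` G & inner_content G <= content K + e%:E].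
Proof.
move=> e0; have [_ [K [cK KG] <-] h] := ub_ereal_sup_adherent e0 (inner_fin G).
by exists K; split => //; rewrite -leeBlDr// ltW.
Qed.

(** A compact subset of the union meets the definition of [inner_content] through finitely many of
    the [G i], where subadditivity follows from [innerU] by induction. *)
Let inner_bigcup (G : nat -> set T) : (forall i, open (G i)) ->
  inner_content (\bigcup_i G i) <= \sum_(i <oo) inner_content (G i).
Proof.
move=> oG; apply: inner_le => K cK KG.
have [|||U [oU KU [n Un]]] := compact_open_ind
  (P := fun U => exists n, U `<=` \big[setU/set0]_(i < n) G i) cK.
- by exists 0%N; rewrite big_ord0.
- move=> A B [m Am] [n Bn]; exists (maxn m n); rewrite subUset; split.
    by apply: subset_trans Am _; apply: subset_bigsetU; exact: leq_maxl.
  by apply: subset_trans Bn _; apply: subset_bigsetU; exact: leq_maxr.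
- move=> x /KG[i _ Gix]; exists (G i); split => //; exists i.+1.
  by rewrite big_ord_recr/=; exact: subsetUr.
have sub m : open (\big[setU/set0]_(i < m) G i) /\
    inner_content (\big[setU/set0]_(i < m) G i) <= \sum_(i < m) inner_content
      (G i).
  elim: m => [|m [om IH]].
    rewrite !big_ord0; split; first exact: open0.
    by rewrite (le_trans (inner_nu open0))// lee_fin;
      have := nu_add.2 set0 set0 (setI0 _);
      rewrite setU0; lra.
  rewrite !big_ord_recr/=; split; first exact: openU.
  by rewrite (le_trans (innerU om (oG m)))// leeD2r.
apply: (@le_trans _ _ (\sum_(i < n) inner_content (G i))).
  rewrite (le_trans _ (sub n).2)// inner_ub//.
  exact: subset_trans KU Un.
rewrite -(big_mkord xpredT (fun i => inner_content (G i))).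
exact: nneseries_lim_ge.
Qed.

Let outer_ub E G : open G -> E `<=` G -> outer_content E <= inner_content G.
Proof. by move=> oG EG; apply: ereal_inf_lbound; exists G. Qed.

Let outer_open G : open G -> outer_content G = inner_content G.
Proof.
move=> oG; apply/eqP; rewrite eq_le outer_ub//=.
by apply: le_ereal_inf_tmp => _ [H [oH GH] <-]; exact: le_inner.
Qed.

Let outer_ge0 E : 0 <= outer_content E.
Proof. by apply: le_ereal_inf_tmp => _ [G _ <-]. Qed.

Let outer_fin E : outer_content E \is a fin_num.
Proof.
rewrite ge0_fin_numE// (le_lt_trans (outer_ub openT _))//.
by rewrite -ge0_fin_numE.
Qed.

Let outer_adh E (e : R) : (0 < e)%R ->
  exists G, [/\ open G, E `<=` G & inner_content G <= outer_content E + e%:E].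
Proof.
move=> e0; have [_ [G [oG EG] <-] /ltW ?] :=
  lb_ereal_inf_adherent e0 (outer_fin E).
by exists G.
Qed.

Let outer0 : outer_content set0 = 0.
Proof.
rewrite outer_open; last exact: open0.
apply/eqP; rewrite eq_le inner_ge0 andbT (le_trans (inner_nu open0))// lee_fin.
by have := nu_add.2 set0 set0 (setI0 _); rewrite setU0; lra.
Qed.

Let le_outer E F : E `<=` F -> outer_content E <= outer_content F.
Proof.
move=> EF; apply: le_ereal_inf_tmp => _ [G [oG FG] <-].
by apply: outer_ub => //; exact: subset_trans FG.
Qed.

Let outer_sigma_subadditive : sigma_subadditive outer_content.
Proof.
move=> F; apply/lee_addgt0Pr => e e0.
have /choice[G GP] : forall i, exists G, [/\ open G, F i `<=` G &
    inner_content G <= outer_content (F i) + (e / (2 ^ i.+1)%:R)%:E].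
  by move=> i; apply: outer_adh; rewrite divr_gt0// ltr0n expn_gt0.
apply: (@le_trans _ _ (inner_content (\bigcup_i G i))).
  apply: outer_ub; first by apply: bigcup_open => i _; have [] := GP i.
  by apply: subset_bigcup => i _; have [] := GP i.
rewrite (le_trans (inner_bigcup _))//; first by move=> i; have [] := GP i.
apply: le_trans (epsilon_trick xpredT (fun i => outer_ge0 (F i)) (ltW e0)).
by apply: lee_nneseries => // i _; have [] := GP i.
Qed.

HB.instance Definition _ := isOuterMeasure.Build R T outer_content
  outer0 outer_ge0 le_outer outer_sigma_subadditive.

(** Nearly optimal compact sets are chosen one after the other: [K] in [V] and [G], then [L] in
    [V \ K]. The latter set is open and contains the part of [V] outside [G], which itself need not
    be open; and [K], [L] are disjoint, so that their contents add up. *)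
Lemma open_outer_content_caratheodory G :
  open G -> outer_content.-caratheodory G.
Proof.
move=> oG; apply: le_caratheodory_measurable => A.
apply: le_ereal_inf_tmp => _ [V [oV AV] <-].
apply: (@le_trans _ _ (outer_content (V `&` G) + outer_content (V `&` ~` G))).
  by apply: leeD; apply: le_outer; exact: setSI.
rewrite (outer_open (openI oV oG)).
apply/lee_addgt0Pr => e e0.
have e20 : (0 < e / 2)%R by rewrite divr_gt0.
have [K [cK KVG hK]] := inner_adh (V `&` G) e20.
have oVK : open (V `\` K).
  by apply: openI => //; apply: closed_openC; exact: compact_closed.
have [L [cL LVK hL]] := inner_adh (V `\` K) e20.
have -> : e%:E = (e / 2)%:E + (e / 2)%:E by rewrite -EFinD -splitr.
have hVG : outer_content (V `&` ~` G) <= inner_content (V `\` K).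
  by apply: outer_ub => // x [Vx nGx]; split => // /KVG[].
rewrite (le_trans (leeD hK (le_trans hVG hL)))// addeACA leeD2r//.
rewrite (le_trans (contentU_disj cK cL _))//.
  by apply/seteqP; split => // x [Kx /LVK[]].
apply: inner_ub; first exact: compactU.
by rewrite subUset; split => x; [move/KVG => []|move/LVK => []].
Qed.

Definition borel_content (A : set (borel T)) : \bar R := outer_content A.

Lemma borel_caratheodory (A : set (borel T)) : measurable A ->
  outer_content.-cara.-measurable A.
Proof.
have sub : @open T `<=` outer_content.-cara.-measurable.
  exact: open_outer_content_caratheodory.
apply: smallest_sub => //; split.
- exact: measurable0.
- by move=> B mB; rewrite setTD; exact: measurableC.
- by move=> B mB; exact: bigcupT_measurable.
Qed.

Let borel_content_sigma_additive : semi_sigma_additive borel_content.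
Proof.
move=> F mF tF mUF.
apply: (@caratheodory_measure_sigma_additive R T outer_content) => //.
- by move=> i; exact: borel_caratheodory.
- exact: borel_caratheodory.
Qed.

HB.instance Definition _ := isMeasure.Build _ _ _ borel_content
  outer0 outer_ge0 borel_content_sigma_additive.

Lemma borel_content_compact K : compact K -> borel_content K = content K.
Proof.
move=> cK; apply/eqP; rewrite eq_le; apply/andP; split.
  apply: le_ereal_inf_tmp => _ [G [oG KG] <-].
  by rewrite (le_trans (outer_ub oG KG))// inner_nu.
by apply: le_ereal_inf_tmp => _ [G [oG KG] <-]; exact: inner_ub.
Qed.

Hypothesis nu_tight : forall e : R, (0 < e)%R ->
  exists2 K, compact K & (1 - e <= nu K)%R.

(** Approximation by compact sets could lose mass in general. Since [content] dominates [nu], the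
    compact sets of [nu_tight] bring the total back to 1. *)
Lemma borel_contentT : borel_content setT = 1.
Proof.
rewrite /borel_content outer_open; last exact: openT.
apply/eqP; rewrite eq_le; apply/andP; split.
  by apply: inner_le => K _ _; exact: content_le1.
apply/lee_addgt0Pr => e e0; have [K cK hK] := nu_tight e0.
rewrite (@le_trans _ _ ((nu K)%:E + e%:E))//.
  by rewrite -EFinD lee_fin; lra.
by rewrite leeD2r// (le_trans (content_lb K))// inner_ub.
Qed.

HB.instance Definition _ := Measure_isProbability.Build _ _ _ borel_content
  borel_contentT.

(** Approximation from outside by open sets is built into [outer_content]. Applied to the complement
    of [A] it yields an open [G] such that [K \ G] is a compact subset of [A]; what is missed lies
    in [G] and [A], or outside [K]. *)
Lemma borel_content_tight : tight (borel_content : probability (borel T) R).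
Proof.
have mc (K : set T) : compact K -> measurable (K : set (borel T)).
  move=> cK; rewrite -[K]setCK; apply: measurableC; apply: sub_sigma_algebra.
  by apply: closed_openC; exact: compact_closed.
move=> A mA; apply/eqP; rewrite eq_le; apply/andP; split; last first.
  apply: ge_ereal_sup => _ [->//|[K [cK KA] <-]].
  exact: le_outer.
apply/lee_addgt0Pr => e e0.
have e20 : (0 < e / 2)%R by rewrite divr_gt0.
have [G [oG AG hG]] := outer_adh (~` A) e20.
have [K cK hK] := nu_tight e20.
have mG : measurable (G : set (borel T)) by exact: sub_sigma_algebra.
pose P : probability (borel T) R := borel_content.
have cKG : compact (K `\` G) by exact: compactDopen.
have PA : P A <= P (K `\` G) + P (G `&` A) + P (~` K).
  have mKG : measurable (K `\` G : set (borel T)) by exact: mc.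
  have mGA : measurable (G `&` A : set (borel T)) by exact: measurableI.
  have mnK : measurable (~` K : set (borel T)) by apply: measurableC; exact: mc.
  rewrite (@le_trans _ _ (P ((K `\` G) `|` (G `&` A) `|` ~` K)))//.
    apply: le_measure; rewrite ?inE//.
      by apply: measurableU => //; exact: measurableU.
    move=> x Ax; have [Kx|] := pselect (K x); last by right.
    by left; have [Gx|] := pselect (G x); [right|left].
  rewrite (le_trans (outer_measureU2 outer_content _ _))// leeD2r//.
  exact: outer_measureU2.
have PnK : P (~` K) <= (e / 2)%:E.
  rewrite probability_setC; last exact: mc.
  rewrite leeBlDr ?fin_num_measure//; last exact: mc.
  rewrite [P K]borel_content_compact// addeC.
  rewrite (@le_trans _ _ ((nu K)%:E + (e / 2)%:E))//.
    by rewrite -EFinD lee_fin; lra.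
  by rewrite leeD2r.
(* [G] is the disjoint union of this set and of the complement of [A], whose mass [G] exceeds by at
   most [e / 2]. *)
have PGA : P (G `&` A) <= (e / 2)%:E.
  have : P G <= P (~` A) + (e / 2)%:E by rewrite [P G]outer_open.
  have mnA : measurable (~` A : set (borel T)) by exact: measurableC.
  have {1}-> : G = (G `&` A) `|` ~` A.
    apply/seteqP; split => x; last by case=> [[]|/AG].
    by move=> Gx; have [Ax|nAx] := pselect (A x); [left|right].
  rewrite measureU//; last by rewrite -setIA setICr setI0.
    by rewrite addeC leeD2lE// fin_num_measure.
  exact: measurableI.
have PKG : P (K `\` G) <= ereal_sup ([set 0] `|`
    [set P K | K in [set K | compact K /\ K `<=` A]]).
  apply: ereal_sup_ubound; right; exists (K `\` G) => //; split => // x [_ nGx].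
  by apply: contrapT => nAx; apply: nGx; exact: AG.
rewrite (le_trans PA)// -addeA leeD//.
rewrite (le_trans (leeD PGA PnK))// -EFinD -splitr//.
Qed.

Lemma tight_probability_of_content : exists P : probability (borel T) R,
  tight P /\ forall K, compact K -> (nu K)%:E <= P K.
Proof.
exists borel_content; split; first exact: borel_content_tight.
by move=> K cK /=; rewrite [leRHS]borel_content_compact.
Qed.

End content.

Lemma compact_borel (T : ptopologicalType) (K : set T) :
  hausdorff_space T -> compact K -> measurable (K : set (borel T)).
Proof.
move=> hT cK; rewrite -[K]setCK; apply: measurableC; apply: sub_sigma_algebra.
by apply: closed_openC; exact: compact_closed.
Qed.

Lemma continuous_borel (S T : ptopologicalType) (f : S -> T) :
  continuous f -> measurable_fun setT (f : borel S -> borel T).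
Proof.
move=> cf; apply: (@measurability _ _ (borel S) (borel T) setT f (@open T)) =>
  // _ [G oG <-].
by rewrite setTI; apply: sub_sigma_algebra; exact: open_comp.
Qed.

Lemma tight_lifting (R : realType) (E X : ptopologicalType)
    (hE : hausdorff_space E) (hX : hausdorff_space X)
    (f : E -> X) (cf : continuous f) (U : set E) (X0 : set X) (KK : set (set X))
    (mu : probability (borel X) R) :
  X0 `<=` f @` U -> (forall K, KK K -> compact K /\ K `<=` X0) ->
  inner_regular mu KK -> (forall K, KK K -> compact (f @^-1` K `&` U)) ->
  exists P : probability (borel E) R, [/\ tight P,
    (exists V : set (borel E), [/\ measurable V, V `<=` U & P (~` V) = 0%E]) &
    forall A : set (borel X), measurable A -> P (f @^-1` A) = mu A].
Proof.
move=> X0f KKc reg cU.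
have [nu0 nu0_add nu0mu] := finitely_additive_extension mu.
have /choice[s sP] : forall x, exists u, X0 x -> U u /\ f u = x.
  move=> x; have [/X0f[u Uu <-]|nx] := pselect (X0 x); first by exists u.
  by exists point.
pose nu (B : set E) := nu0 (s @^-1` B).
have nu_add : finitely_additive nu.
  split=> [B|B C BC]; first exact: nu0_add.1.
  by rewrite /nu preimage_setU nu0_add.2// -preimage_setI BC preimage_set0.
have nuT : nu setT = 1.
  have <- : fine (mu setT) = 1 by rewrite probability_setT.
  exact: nu0mu measurableT.
have mK K : KK K -> measurable (K : set (borel X)).
  by move=> /KKc[cK _]; exact: compact_borel.
have nuK K : KK K -> (mu K <= (nu (f @^-1` K `&` U))%:E)%E.
  move=> KK_K; rewrite -[leLHS]fineK ?fin_num_measure//; last exact: mK.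
  rewrite lee_fin -nu0mu; last exact: mK.
  apply: (finitely_additive_le (nu := nu0)) => // x Kx.
  by have [Us fs] := sP x ((KKc _ KK_K).2 x Kx); split => //=; rewrite fs.
have bigK (e : R) : 0 < e -> exists2 K, compact (f @^-1` K `&` U) &
    1 - e <= nu (f @^-1` K `&` U).
  move=> e0; have : ((1 - e)%:E < mu setT)%E.
    by rewrite probability_setT lte_fin; lra.
  rewrite reg// => /ereal_sup_gt[_ [->|[K [KK_K _] <-]]].
    (* The extra value 0 in the supremum of [inner_regular] is above [1 - e] only when [e > 1], and
       then the empty set is good enough. *)
    rewrite lte_fin => e1; exists set0; first by rewrite preimage_set0 set0I;
      exact: compact0.
    by rewrite (le_trans (ltW e1))// nu_add.1.
  move=> /ltW/le_trans/(_ (nuK _ KK_K)); rewrite lee_fin => h.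
  by exists K => //; exact: cU.
have nu_tight (e : R) : 0 < e -> exists2 K, compact K & 1 - e <= nu K.
  by move=> /bigK[K cK hK]; exists (f @^-1` K `&` U).
have [P [tP nuP]] := tight_probability_of_content hE nu_add nuT nu_tight.
(* For [K] in the family, [mu K] is at most the [nu]-mass of the compact lift of [K], hence at most
   its [P]-mass; regularity of [mu] passes from such [K] to Borel sets. *)
have lePmu (A : set (borel X)) : measurable A -> (mu A <= P (f @^-1` A))%E.
  move=> mA; rewrite reg//; apply: ge_ereal_sup => _ [->//|[K [KK_K KA] <-]].
  rewrite (le_trans (nuK _ KK_K))// (le_trans (nuP _ (cU _ KK_K)))//.
  apply: le_measure; rewrite ?inE.
  - by apply: compact_borel => //; exact: cU.
  - by rewrite -[_ @^-1` _]setTI; exact: continuous_borel.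
  - by move=> u [Ku _]; exact: KA.
exists P; split => //; last first.
  move=> A mA; have mfA : measurable (f @^-1` A : set (borel E)).
    by rewrite -[_ @^-1` _]setTI; exact: continuous_borel.
  apply/eqP; rewrite eq_le lePmu// andbT.
  have := lePmu _ (measurableC mA).
  rewrite preimage_setC !probability_setC//.
  have Pf := fin_num_measure P _ mfA; have mf := fin_num_measure mu _ mA.
  rewrite -(fineK Pf) -(fineK mf) => h;
    have {}h : ((1 - fine (mu A))%:E <= (1 - fine (P (f @^-1` A)))%:E)%E by
      exact: h.
  move: h.
  by rewrite !lee_fin; lra.
(* [U] need not be Borel; a countable union of compact subsets of [U], of masses at least
   [1 - 1/(n+1)], carries [P] in its place. *)
have /choice[K KP] : forall n : nat, exists K, compact (f @^-1` K `&` U) /\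
    1 - n.+1%:R^-1 <= nu (f @^-1` K `&` U).
  move=> n; have [|K cK hK] := bigK n.+1%:R^-1; first by rewrite invr_gt0 ltr0n.
  by exists K.
have mKn n : measurable (f @^-1` K n `&` U : set (borel E)).
  by apply: compact_borel => //; have [] := KP n.
have mV : measurable (\bigcup_n (f @^-1` K n `&` U) : set (borel E)).
  exact: bigcupT_measurable.
exists (\bigcup_n (f @^-1` K n `&` U)); split=> //.
  by move=> u [n _ []].
apply/eqP; rewrite eq_le measure_ge0 andbT; apply/lee_addgt0Pr => e e0.
rewrite add0e probability_setC// leeBlDr ?fin_num_measure// -leeBlDl//.
have [n ne] : exists n : nat, n.+1%:R^-1 <= e.
  exists (Num.truncn e^-1); rewrite invf_ple ?posrE// ltW//.
  by rewrite truncnS_gt.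
have [cKn hKn] := KP n.
apply: (@le_trans _ _ (P (f @^-1` K n `&` U))).
  by rewrite (le_trans _ (nuP _ cKn))// -EFinB lee_fin (le_trans _ hKn)// lerB.
apply: le_measure; rewrite ?inE//.
by move=> u uK; exists n.
Qed.

(** * Time intervals and path spaces *)

Section time_topology.
Context {R : realType} {I : left_closed_itv R}.
Implicit Types (s t a b : time I) (A K : set (time I)).

Lemma time_val_inj : injective (@time_val R I).
Proof. by move=> s t /val_inj. Qed.

Lemma time_val_continuous : continuous (@time_val R I).
Proof. exact: initial_continuous. Qed.

Lemma time_min_le t : time_val (time_min I) <= time_val t.
Proof. by apply: (@itv_left_le _ I); exact: set_valP. Qed.

Lemma nbhs_timeP t A : nbhs t A <->
  exists2 e : R, 0 < e & forall s, `|time_val s - time_val t| < e -> A s.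
Proof.
split=> [|[e e0 eA]].
  rewrite nbhsE => -[B [[G oG <-] Bt] BA].
  have /nbhs_ballP[e /= e0 eO] : nbhs (time_val t) G by exact: open_nbhs_nbhs.
  exists e => // s st; apply: BA; apply: eO.
  by rewrite -ball_normE/= distrC.
have : nbhs t (@time_val R I @^-1` ball (time_val t) e).
  by apply: time_val_continuous; exact: nbhsx_ballx.
by apply: filterS => s; rewrite -ball_normE/= distrC; exact: eA.
Qed.

Lemma time_between a b (x : R) : time_val a <= x <= time_val b ->
  exists s, time_val s = x.
Proof.
move=> axb; have Ix : itv_set I x.
  by apply: (itv_setP _ _ axb); exact: set_valP.
by exists (SigSub (mem_set Ix)).
Qed.

Lemma time_segmentE a b :
  @time_val R I @` time_segment a b = `[time_val a, time_val b]%classic.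
Proof.
apply/seteqP; split => [_ [s sab <-]|x]; first by rewrite /= in_itv.
rewrite /= in_itv/= => axb; have [s sx] := time_between axb.
by exists s => //; rewrite /time_segment/= sx.
Qed.

(** A filter on [K] is pushed to the real line, where it clusters at a point of [C]. That point is a
    time of [K], and neighbourhoods in [I] are given by real distances. *)
Lemma compact_time_preimage (C : set R) (K : set (time I)) :
  compact C -> @time_val R I @` K = C -> compact K.
Proof.
move=> cC KC F FF FK.
have FC : (@time_val R I @ F) C.
  change (F (@time_val R I @^-1` C)).
  by apply: (@filterS _ F _ K) => // s Ks; rewrite /= -KC; exists s.
have [x [Cx clx]] := cC _ _ FC; move: (Cx); rewrite -KC => -[s Ks sx].
exists s; split => // A B FA /nbhs_timeP[e e0 eB].
have [] := clx (@time_val R I @` A) (ball x e) _ _.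
- by apply: (@filterS _ F _ A) => // r Ar; exists r.
- exact: nbhsx_ballx.
move=> _ [[r Ar <-]]; rewrite -ball_normE/= => xr.
by exists r; split => //; apply: eB; rewrite sx distrC.
Qed.

Lemma time_segment_compact a b : compact (time_segment a b).
Proof.
by apply: compact_time_preimage (time_segmentE a b); exact: segment_compact.
Qed.

Lemma compact_time_bounded K : compact K ->
  exists b, K `<=` time_segment (time_min I) b.
Proof.
move=> cK; have [|||U [_ KU [b Ub]]] := compact_open_ind
  (P := fun U => exists b, U `<=` time_segment (time_min I) b) cK.
- by exists (time_min I).
- move=> A B [a Aa] [b Bb]; have [ab|ba] := leP (time_val a) (time_val b).
    exists b => s [/Aa|/Bb//]; rewrite /time_segment/= => /andP[-> sa] /=.
    exact: le_trans ab.
  exists a => s [/Aa//|/Bb]; rewrite /time_segment/= => /andP[-> sa] /=.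
  exact: le_trans (ltW ba).
(* Either some time [b] lies beyond [t], and the times before [b] form a neighbourhood of [t]; or
   [t] is the right end point and bounds all of [I]. *)
- move=> t Kt; have [[b tb]|nb] := pselect (exists b, time_val t < time_val b).
    exists [set s | time_val s < time_val b]; split => //.
      apply: (open_comp (f := @time_val R I) (D := [set x | x < time_val b])).
        by move=> ? _; exact: time_val_continuous.
      exact: open_lt.
    by exists b => s /= sb; rewrite /time_segment/= time_min_le ltW.
  exists setT; split => //; first exact: openT.
  exists t => s _; rewrite /time_segment/= time_min_le/= leNgt;
    apply/negP => ts.
  by apply: nb; exists s.
by exists b; exact: subset_trans KU Ub.
Qed.

Lemma time_val_measurable : measurable_fun setT (@time_val R I).
Proof.
move=> _ B mB; rewrite setTI /measurable/= /lebesgue_measurable_time.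
have -> : @time_val R I @` (@time_val R I @^-1` B) = itv_set I `&` B.
  apply/seteqP; split=> [_ [s Bs <-]|x [Ix Bx]]; first by split;
    [exact: set_valP|].
  by exists (SigSub (mem_set Ix)).
apply: sub_caratheodory; apply: measurableI => //.
by have /is_intervalP -> := @itv_setP _ I; exact: measurable_itv.
Qed.

Lemma compact_time_measurable K : compact K -> measurable K.
Proof.
move=> cK; have -> : K = @time_val R I @^-1` (@time_val R I @` K).
  by apply/seteqP; split=> [s Ks|s [r Kr /time_val_inj <-]//]; exists s.
rewrite -[X in measurable X]setTI; apply: time_val_measurable => //.
apply: compact_measurable; apply: continuous_compact => //.
exact: continuous_subspaceT time_val_continuous.
Qed.

Lemma time_segment_measurable a b : measurable (time_segment a b).
Proof. by apply: compact_time_measurable; exact: time_segment_compact. Qed.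

Lemma lebesgue_time_measurable (B : set R) : measurable B ->
  lebesgue_time I (@time_val R I @^-1` B) = lebesgue_measure (itv_set I `&` B).
Proof.
move=> mB; rewrite /lebesgue_time; congr (_ _).
apply/seteqP; split=> [_ [s Bs <-]|x [Ix Bx]]; first by split;
  [exact: set_valP|].
by exists (SigSub (mem_set Ix)).
Qed.

Lemma lebesgue_time_segment a b : time_val a <= time_val b ->
  lebesgue_time I (time_segment a b) = (time_val b - time_val a)%:E.
Proof.
move=> ab; rewrite /lebesgue_time time_segmentE.
(* The completed measure and Lebesgue measure are the same outer measure on two sigma-algebras, so
   both sides are convertible. *)
transitivity (lebesgue_measure (`[time_val a, time_val b]%classic : set R)).
  by [].
by rewrite lebesgue_measure_itv/= lte_fin; case: ltgtP ab => // ->;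
  rewrite subrr.
Qed.

Lemma lebesgue_time_sigma_finite : sigma_finite setT (lebesgue_time I).
Proof.
exists (fun n => @time_val R I @^-1` `]-oo, n%:R]).
  apply/esym/seteqP; split => // s _;
    exists (Num.truncn (time_val s)).+1 => //=.
  by rewrite in_itv/= ltW// truncnS_gt.
move=> n; have mn : measurable (@time_val R I @^-1` `]-oo, n%:R]).
  by rewrite -[X in measurable X]setTI; exact: time_val_measurable.
split=> //; rewrite lebesgue_time_measurable//.
apply: (@le_lt_trans _ _ (lebesgue_measure `[time_val (time_min I),
  n%:R]%classic)).
  apply: le_measure; rewrite ?inE//=.
  - apply: measurableI => //.
    by have /is_intervalP -> := @itv_setP _ I; exact: measurable_itv.
  - move=> x [Ix]; rewrite /= !in_itv/= => ->; rewrite andbT.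
    exact: (@itv_left_le _ I).
by rewrite lebesgue_measure_itv/=; case: ifP => _; rewrite ltry.
Qed.

HB.instance Definition _ :=
  @Measure_isSigmaFinite.Build _ _ _ (lebesgue_time I)
    lebesgue_time_sigma_finite.

End time_topology.

Section paths_topology.
Context {R : realType} {I : left_closed_itv R} {X : ptopologicalType}.

Lemma open_paths (J : set (time I)) (G : set X) : compact J -> open G ->
  open [set u : paths I X | (u : time I -> X) @` J `<=` G].
Proof. by move=> cJ oG; eexists; [exact: (compact_open_open cJ oG)|]. Qed.

Lemma eval_at_continuous (t : time I) : continuous (@eval_at R I X t).
Proof.
apply/continuousP => G oG.
rewrite (_ : _ @^-1` _ = [set u : paths I X | (u :
  time I -> X) @` [set t] `<=` G]).
  by apply: open_paths => //; exact: compact_set1.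
apply/seteqP; split=> [u Gu _ [_ -> <-]//|u]; by apply; exists t.
Qed.

Lemma paths_hausdorff : hausdorff_space X -> hausdorff_space (paths I X).
Proof.
move=> hX u v uv; apply/continuousEP => t; apply: hX => A B uA vB.
have [w [wA wB]] := uv _ _ (eval_at_continuous uA) (eval_at_continuous vB).
by exists (eval_at t w).
Qed.

Definition eval_pair (p : time I * paths I X) : X := p.2 p.1.

(* X need not be second countable; the countability comes from I, by covering
   the preimage of an open G with the sets J x {u | u(J) <= G}, where J ranges
   over the compact traces on I of intervals with rational end points. *)
Lemma eval_pair_measurable :
  measurable_fun setT (eval_pair : time I * borel (paths I X) -> borel X).
Proof.
apply: (@measurability _ _ _ (borel X) setT _ (@open X)) => // _ [G oG <-].
rewrite setTI.
pose J (pq : rat * rat) := [set s :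
  time I | ratr pq.1 <= time_val s <= ratr pq.2].
pose D := [set pq | compact (J pq)].
have -> : eval_pair @^-1` G = \bigcup_(pq in D)
    (J pq `*` [set u : paths I X | (u : time I -> X) @` J pq `<=` G]).
  apply/seteqP; split=> [[t u] Gtu|[t u] [pq _ [/= Jt]]]; last first.
    by apply; exists t.
  have : nbhs t ((u : time I -> X) @^-1` G).
    have cu : continuous (u : time I -> X) by exact: cts_fun.
    by apply: (cu t); exact: open_nbhs_nbhs.
  move=> /nbhs_timeP[e e0 eG].
  have [|p tp] := @rat_in_itvoo R (time_val t - e) (time_val t).
    by rewrite ltrBlDr ltrDl.
  (* The trace of the rational interval must be compact even if [I] lacks its right end point. Its
     upper end is therefore kept below [x], beyond which no time past [b] is needed: [b] is a time
     after [t], or [t] itself when [t] is the last time. *)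
  have [b [x [tx xe xb]]] : exists (b : time I) (x :
    R), [/\ time_val t < x, x <= time_val t + e &
      forall s : time I, time_val s <= x -> time_val s <= time_val b].
    have [[b tb]|nb] := pselect (exists b : time I, time_val t < time_val b).
      exists b, (Num.min (time_val b) (time_val t + e)); split.
      - by rewrite lt_min tb ltrDl.
      - by rewrite ge_min lexx orbT.
      - by move=> s; rewrite le_min => /andP[].
    exists t, (time_val t + e); split=> [|//|s _]; first by rewrite ltrDl.
    by rewrite leNgt; apply/negP => ts; apply: nb; exists s.
  have [q] := rat_in_itvoo tx; rewrite in_itv/= => /andP[tq qx].
  move: tp; rewrite in_itv/= => /andP[ep pt].
  exists (p, q); last first.
    split=> [/=|_ [s /andP[ps sq] <-]]; first by rewrite /J/= (ltW pt) (ltW tq).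
    have := eG s; apply; move: ps sq => /= ps sq; rewrite ltr_norml;
      apply/andP; split; lra.
  apply: (@subclosed_compact _ _ (time_segment (time_min I) b)).
  - apply: (closed_comp (f := @time_val R I) (D :=
      [set x | ratr p <= x <= ratr q])).
      by move=> ? _; exact: time_val_continuous.
    have -> : [set x : R | ratr p <= x <= ratr q] = `[ratr p, ratr q]%classic.
      by apply/seteqP; split => y /=; rewrite in_itv.
    exact: interval_closed.
  - exact: time_segment_compact.
  - move=> s /= /andP[ps sq]; rewrite /time_segment/= time_min_le/= xb//.
    by rewrite (le_trans sq)// ltW.
rewrite bigcup_mkcond; apply: countable_bigcupT_measurable => [|[p q]].
  exact: countableP.
case: ifPn => [|_]; last exact: measurable0.
rewrite inE => cJ; apply: measurableX; first exact: compact_time_measurable.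
by apply: sub_sigma_algebra; exact: open_paths.
Qed.

End paths_topology.

(** * Smooth plateau functions *)

Section smooth_functions.
Context {R : realType}.
Implicit Types (f g : R -> R) (a b x y : R).

(** The powers of [x^-1] are there because each derivation of exp(-1/x) produces new ones: the
    derivative of a member is a linear combination of members. *)
Definition flat (k : nat) x : R :=
  if 0 < x then x^-1 ^+ k * expR (- x^-1) else 0.

Lemma flat_gt0 k x : 0 < x -> 0 < flat k x.
Proof. by move=> x0; rewrite /flat x0 mulr_gt0 ?expR_gt0// exprn_gt0//
  invr_gt0. Qed.

Lemma flat_eq0 k x : x <= 0 -> flat k x = 0.
Proof. by rewrite /flat leNgt => /negbTE ->. Qed.

Lemma flat_ge0 k x : 0 <= flat k x.
Proof. by have [/flat_eq0->//|/flat_gt0/ltW] := leP x 0. Qed.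

(** With z = 1/x this is the term of degree k+2 of the exponential series, z^(k+2)/(k+2)! <= exp z.
    It serves only to see that [flat] tends to 0 at the origin. *)
Lemma flat_le k x : flat k x <= (k.+2)`!%:R * x ^+ 2.
Proof.
have [x0|x0] := leP x 0; first by rewrite flat_eq0// mulr_ge0// sqr_ge0.
rewrite /flat x0; set z := x^-1.
have z0 : 0 < z by rewrite invr_gt0.
have -> : x = z^-1 by rewrite invrK.
clearbody z.
rewrite expRN ler_pdivrMr ?expR_gt0//.
have := expR_ge1Dxn k.+1 (ltW z0).
have f0 : 0 < (k.+2)`!%:R :> R by rewrite ltr0n fact_gt0.
move=> h; have {}h : z ^+ k.+2 / k.+2`!%:R <= expR z by apply: le_trans h;
  rewrite lerDr.
move: h; rewrite ler_pdivrMr// => h.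
rewrite exprVn mulrAC ler_pdivlMr ?exprn_gt0// -exprD addn2.
by rewrite mulrC.
Qed.

Lemma is_derive_flat k x : is_derive x 1 (flat k) (flat k.+2 x - k%:R * flat
  k.+1 x).
Proof.
have [x0|x0|->] := ltgtP x 0.
- rewrite !flat_eq0 ?ltW// mulr0 subr0.
  apply: (near_eq_is_derive (f := cst (0 : R))).
  by apply: filterS (lt_nbhsl x0) => y /ltW/flat_eq0 ->.
- apply: (near_eq_is_derive (f := fun y => y^-1 ^+ k * expR (- y^-1))).
    by apply: filterS (lt_nbhsr x0) => y y0; rewrite /flat y0.
  have xn0 : x != 0 by rewrite gt_eqF.
  have dV : is_derive x 1 (fun y : R => y^-1) (- x ^- 2).
    by have := is_deriveV (f := id) xn0 (is_derive_id x 1);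
      rewrite /GRing.scale/= mulr1.
  have dE : is_derive x 1 (fun y : R => expR (- y^-1)) (x ^- 2 * expR (- x^-1)).
    have dN : is_derive x 1 (fun y : R => - y^-1) (x ^- 2).
      by apply: is_derive_eq; rewrite opprK.
    have := is_derive1_comp (g := fun y => - y^-1) (is_derive_expR (- x^-1)) dN.
    by rewrite mulrC.
  have dX : is_derive x 1 (fun y : R =>
    y^-1 ^+ k) (k%:R * x^-1 ^+ k.-1 * (- x ^- 2)).
    have := @is_deriveX _ _ (fun y => y^-1) k x 1 _ dV.
    by rewrite exprfctE.
  have := is_deriveM dX dE; rewrite /GRing.scale/= => h.
  apply: (is_derive_eq h); rewrite /flat x0.
  case: k {dX h} => [|k]; rewrite ?mul0r ?mulr0n ?subr0 ?addr0 /=.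
    by rewrite -!exprVn expr0; ring.
  by rewrite -!exprVn !exprS; ring.
- rewrite !flat_eq0// mulr0 subr0.
  (* The difference quotient of [flat k] at 0 is [flat k.+1] itself, which is squeezed to 0 by
     [flat_le]. *)
  apply/is_derive1_caratheodory.
  exists (flat k.+1); split; last exact: flat_eq0.
    move=> z; rewrite (@flat_eq0 k 0)// !subr0 /flat; case: ifPn => z0.
      by rewrite exprS; field; rewrite gt_eqF.
    by rewrite mul0r.
  rewrite /prop_for /continuous_at flat_eq0//.
  apply: (squeeze_cvgr (f := cst 0) (h := fun y => (k.+3)`!%:R * y ^+ 2)).
  - by apply: nearW => y; rewrite flat_ge0 flat_le.
  - exact: cvg_cst.
  - have := cvgM (cvg_cst ((k.+3)`!%:R : R)) (@exprn_continuous R 2 0).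
    rewrite expr0n mulr0; apply.
Qed.

(* A class of functions closed under derivation, so that its members are
   infinitely differentiable; it contains all the test functions needed. *)
Inductive smooth : (R -> R) -> Prop :=
| smooth_flat k a b : smooth (fun x => flat k (a * x + b))
| smooth_cst a : smooth (fun=> a)
| smoothD f g : smooth f -> smooth g -> smooth (fun x => f x + g x)
| smoothM f g : smooth f -> smooth g -> smooth (fun x => f x * g x)
| smoothV f : smooth f -> (forall x, f x != 0) -> smooth (fun x => (f x)^-1).

Lemma smooth_derive f : smooth f ->
  exists2 f', smooth f' & forall x, is_derive x 1 f (f' x).
Proof.
elim=> {f}.
- move=> k a b.
  exists (fun x => a * (flat k.+2 (a * x + b) + (- k%:R) * flat k.+1 (a * x +
    b))).
    by do ?[exact: smooth_flat|exact: smooth_cst|apply: smoothM|apply: smoothD].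
  move=> x.
  have dl : is_derive x 1 (fun x => a * x + b) a.
    by apply: is_derive_eq; rewrite /GRing.scale/=; ring.
  have := is_derive1_comp (g := fun x =>
    a * x + b) (is_derive_flat k (a * x + b)) dl.
  by move=> h; apply: is_derive_eq; ring.
- by move=> a; exists (fun=> 0); [exact: smooth_cst|move=> x;
    exact: is_derive_cst].
- move=> f g _ [f' sf' df] _ [g' sg' dg]; exists (fun x => f' x + g' x).
    exact: smoothD.
  by move=> x; exact: is_deriveD.
- move=> f g sf [f' sf' df] sg [g' sg' dg].
  exists (fun x => f x * g' x + g x * f' x).
    by apply: smoothD; exact: smoothM.
  by move=> x; exact: is_deriveM.
- move=> f sf [f' sf' df] f0.
  exists (fun x => (-1) * ((f x)^-1 * (f x)^-1 * f' x)).
    by do ?[exact: smooth_cst|apply: smoothM|exact: smoothV].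
  move=> x; have := is_deriveV (f0 x) (df x).
  move=> h; apply: is_derive_eq; rewrite /GRing.scale/= expr2 invfM; ring.
Qed.

Lemma smooth_derivable f : smooth f -> forall n x, derivable (derive1n n f) x 1.
Proof.
move=> sf n; rewrite /derive1n; elim: n f sf => [|n IH] f sf x.
  by have [f' _ df] := smooth_derive sf; case: (df x).
have [f' sf' df] := smooth_derive sf.
rewrite iterSr; have -> : derive1 f = f' by apply/funext => y;
  rewrite derive1E derive_val.
exact: IH.
Qed.

Lemma flat_le_homo x y : x <= y -> flat 0 x <= flat 0 y.
Proof.
move=> xy; have [x0|x0] := leP x 0; first by rewrite flat_eq0// flat_ge0.
have y0 : 0 < y by exact: lt_le_trans xy.
by rewrite /flat x0 y0 !expr0 !mul1r ler_expR lerN2 lef_pV2.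
Qed.

(** The usual smooth transition from 0, on the left of 0, to 1, on the right of 1. *)
Definition step x : R := flat 0 x / (flat 0 x + flat 0 (1 - x)).

Lemma step_denom_gt0 x : 0 < flat 0 x + flat 0 (1 - x).
Proof.
have [x0|x0] := leP x 0; last by rewrite ltr_pwDl ?flat_gt0 ?flat_ge0.
by rewrite ltr_wpDl ?flat_ge0// flat_gt0//; lra.
Qed.

Lemma smooth_step a b : smooth (fun x => step (a * x + b)).
Proof.
rewrite /step; apply: smoothM; first exact: smooth_flat.
apply: smoothV => [|x]; last by rewrite gt_eqF// step_denom_gt0.
apply: smoothD; first exact: smooth_flat.
rewrite (_ : (fun x => _) = fun x => flat 0 (- a * x + (1 - b))).
  exact: smooth_flat.
by apply/funext => x; congr flat; ring.
Qed.

Lemma step_ge0 x : 0 <= step x.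
Proof. by rewrite divr_ge0 ?flat_ge0// ltW// step_denom_gt0. Qed.

Lemma step_le1 x : step x <= 1.
Proof. by rewrite ler_pdivrMr ?step_denom_gt0// mul1r lerDl flat_ge0. Qed.

Lemma step_eq0 x : x <= 0 -> step x = 0.
Proof. by move=> x0; rewrite /step flat_eq0// mul0r. Qed.

Lemma step_eq1 x : 1 <= x -> step x = 1.
Proof.
move=> x1; have := step_denom_gt0 x.
rewrite /step (@flat_eq0 _ (1 - x)) ?subr_le0// addr0 => h.
by rewrite divff// gt_eqF.
Qed.

Lemma step_le x y : x <= y -> step x <= step y.
Proof.
move=> xy; rewrite /step ler_pdivrMr ?step_denom_gt0// mulrAC.
rewrite ler_pdivlMr ?step_denom_gt0// !mulrDr [flat 0 y * flat 0 x]mulrC.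
rewrite lerD2l ler_pM ?flat_ge0// flat_le_homo//; lra.
Qed.

(** Product of a rising transition on [a+e, a+2e] and a falling one on [b-2e, b-e], which the
    condition on [e] keeps apart. The margin [e] at each end puts the support inside the open
    interval; the two monotonicity clauses fix the sign of the derivative on each side. *)
Lemma smooth_plateau (a b e : R) : 0 < e -> 4 * e <= b - a ->
  exists theta : R -> R, [/\ smooth theta, forall x, 0 <= theta x <= 1,
   forall x, x <= a + e \/ b - e <= x -> theta x = 0,
   forall x, a + 2 * e <= x <= b - 2 * e -> theta x = 1 &
   (forall x y, x <= y <= b - 2 * e -> theta x <= theta y) /\
   (forall x y, a + 2 * e <= x <= y -> theta y <= theta x)].
Proof.
move=> e0 eab.
have le1 x : x <= b - 2 * e -> step (- e^-1 * x + (b / e - 1)) = 1.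
  move=> xb; apply: step_eq1.
  rewrite [X in _ <= X](_ : _ = (b - x) / e - 1); last by field; rewrite gt_eqF.
  by rewrite lerBrDr ler_pdivlMr//; lra.
have ge1 x : a + 2 * e <= x -> step (e^-1 * x + (- a / e - 1)) = 1.
  move=> xb; apply: step_eq1.
  rewrite [X in _ <= X](_ : _ = (x - a) / e - 1); last by field; rewrite gt_eqF.
  by rewrite lerBrDr ler_pdivlMr//; lra.
have ei0 : 0 < e^-1 by rewrite invr_gt0.
exists (fun x => step (e^-1 * x + (- a / e - 1)) * step (- e^-1 * x + (b / e -
  1))).
split.
- by apply: smoothM; exact: smooth_step.
- by move=> x; rewrite mulr_ge0 ?step_ge0//= mulr_ile1 ?step_ge0 ?step_le1.
- move=> x [xa|xb].
    rewrite [X in X * _]step_eq0 ?mul0r//.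
    rewrite [X in X <= _](_ : _ = (x - a) / e - 1); last by field;
      rewrite gt_eqF.
    by rewrite subr_le0 ler_pdivrMr//; lra.
  rewrite [X in _ * X]step_eq0 ?mulr0//.
  rewrite [X in X <= _](_ : _ = (b - x) / e - 1); last by field; rewrite gt_eqF.
  by rewrite subr_le0 ler_pdivrMr//; lra.
- by move=> x /andP[ax xb]; rewrite ge1// le1// mulr1.
- split=> x y /andP[].
    move=> xy yb; rewrite !le1//; last exact: le_trans yb.
    by rewrite !mulr1 step_le// lerD2r ler_wpM2l// ltW.
  move=> ax xy; rewrite !ge1//; last exact: le_trans xy.
  by rewrite !mul1r step_le// lerD2r !mulNr lerN2 ler_wpM2l// ltW.
Qed.

End smooth_functions.

(** * Functions of time *)

Lemma Rintegral_dominated_cvg d (T : measurableType d) (R : realType)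
    (mu : {measure set T -> \bar R}) (D : set T) (f_ : (T -> R)^nat)
    (f g : T -> R) :
  measurable D -> (forall n, measurable_fun D (f_ n)) -> measurable_fun D f ->
  {ae mu, forall x, D x -> f_ ^~ x @ \oo --> f x} ->
  mu.-integrable D (EFin \o g) ->
  (forall n x, D x -> `|f_ n x| <= g x) ->
  (\int[mu]_(x in D) f_ n x) @[n --> \oo] --> \int[mu]_(x in D) f x.
Proof.
move=> mD mf_ mf f_f ig f_g.
have [| | | |fi _ cvgf] := @dominated_convergence _ _ _ mu D mD
  (fun n x => (f_ n x)%:E) (EFin \o f) (EFin \o g) _ _ _ ig.
- by move=> n; exact/measurable_EFinP.
- exact/measurable_EFinP.
- apply: filterS f_f => x /[apply] h; apply: cvg_EFin h; exact: nearW.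
- by apply: aeW => x n Dx; rewrite lee_fin f_g.
- apply: fine_cvg; rewrite fineK//; exact: integrable_fin_num.
Qed.

Lemma measurable_fun_open d (T : measurableType d) (R : realType) (f : T -> R) :
  (forall G : set R, open G -> measurable (f @^-1` G)) -> measurable_fun setT f.
Proof.
move=> fG; apply: (measurability _ (RGenOInfty.measurableE R)).
by move=> _ [_ [x ->] <-]; rewrite setTI; apply: fG; exact: interval_open.
Qed.

Section time_integrals.
Context {R : realType} {I : left_closed_itv R}.
Implicit Types (a b m s t : time I) (c f g : time I -> R).
Local Notation leb := (lebesgue_time I).

Lemma continuous_time_measurable c : continuous c -> measurable_fun setT c.
Proof.
move=> cc; apply: measurable_fun_open => G oG.
have [V oV <-] : open (c @^-1` G) by apply: open_comp => // s _; exact: cc.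
by rewrite -[X in measurable X]setTI; apply: time_val_measurable => //;
  exact: open_measurable.
Qed.

Lemma continuous_time_bounded a b c : continuous c ->
  [bounded c s | s in time_segment a b].
Proof.
move=> cc; have /compact_bounded[M [Mr HM]] : compact (c @` time_segment a b).
  apply: continuous_compact; last exact: time_segment_compact.
  exact: continuous_subspaceT.
by exists M; split => // x Mx s abs; apply: HM => //; exists s.
Qed.

Lemma lebesgue_time_segment_lty a b : (leb (time_segment a b) < +oo)%E.
Proof.
have [ab|ba] := leP (time_val a) (time_val b).
  by rewrite lebesgue_time_segment// ltry.
rewrite (_ : time_segment a b = set0) ?measure0//.
by apply/seteqP; split => // s /= /andP[as_ sb]; move: ba;
  rewrite ltNge (le_trans as_ sb).
Qed.

Lemma continuous_loc_integrable c : continuous c -> loc_integrable c.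
Proof.
move=> cc K cK; have [b Kb] := compact_time_bounded cK.
apply: (@integrableS _ _ _ _ (time_segment (time_min I) b)) => //.
- exact: time_segment_measurable.
- exact: compact_time_measurable.
- apply: measurable_bounded_integrable; first exact: time_segment_measurable.
  + exact: lebesgue_time_segment_lty.
  + exact/measurable_funTS/continuous_time_measurable.
  + exact: continuous_time_bounded.
Qed.

Lemma loc_integrable_segment a b f : loc_integrable f ->
  leb.-integrable (time_segment a b) (EFin \o f).
Proof. by apply; exact: time_segment_compact. Qed.

Lemma loc_integrableM c f : continuous c -> loc_integrable f ->
  loc_integrable (fun s => c s * f s).
Proof.
move=> cc fi K cK; have mK := compact_time_measurable cK.
apply: (@integrableMr _ _ _ leb K mK c (EFin \o f)); last exact: fi.
  exact/measurable_funTS/continuous_time_measurable.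
have [b Kb] := compact_time_bounded cK.
have [M [Mr HM]] := continuous_time_bounded (time_min I) b cc.
by exists M; split => // x Mx s Ks; apply: HM => //; exact: Kb.
Qed.

Lemma loc_integrable_norm f : loc_integrable f -> loc_integrable (fun s =>
  `|f s|).
Proof. by move=> fi K cK; exact: integrable_norm (fi K cK). Qed.

Lemma lebesgue_time_set1 a : leb [set a] = 0%E.
Proof.
rewrite (_ : [set a] = time_segment a a).
  by rewrite lebesgue_time_segment// subrr.
apply/seteqP; split => s /=; first by move=> ->; rewrite /time_segment/= lexx.
by rewrite /time_segment/= => /le_anti/time_val_inj ->.
Qed.

Lemma time_set1_measurable a : measurable [set a].
Proof. by apply: compact_time_measurable; exact: compact_set1. Qed.

Lemma time_integral_split a m b f :
  time_val a <= time_val m -> time_val m <= time_val b ->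
  leb.-integrable (time_segment a b) (EFin \o f) ->
  \int[leb]_(s in time_segment a b) f s =
  \int[leb]_(s in time_segment a m) f s + \int[leb]_(s in time_segment m b) f s.
Proof.
move=> am mb fi.
have mS x y : measurable (time_segment x y) := @time_segment_measurable R I x y.
have mbE : \int[leb]_(s in time_segment m b) f s =
    \int[leb]_(s in time_segment m b `\ m) f s.
  congr fine; apply: negligible_integral => //.
  - exact: time_set1_measurable.
  - apply: integrableS fi => // s; rewrite /time_segment/= => /andP[ms ->].
    by rewrite andbT (le_trans am).
  - exact: lebesgue_time_set1.
have abE : time_segment a b = time_segment a m `|` (time_segment m b `\ m).
  apply/seteqP; split => s; rewrite /time_segment/=.
    move=> /andP[as_ sb]; have [sm|ms] := leP (time_val s) (time_val m).
      by left; rewrite as_.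
    by right; rewrite (ltW ms) sb; split=> // sm; move: ms; rewrite sm ltxx.
  by case=> [/andP[-> sm]|[/andP[ms ->] _]]/=; rewrite ?andbT;
    [exact: le_trans mb|exact: le_trans ms].
rewrite mbE abE Rintegral_setU//.
- by apply: measurableD => //; exact: time_set1_measurable.
- by rewrite -abE.
- apply/disj_setPS => s [/= /andP[_ sm] [/andP[ms _]]]; apply.
  by apply: time_val_inj; apply: le_anti; rewrite sm ms.
Qed.

(** The segment lies in [I], so on its subsets the image of the measure of [I] is Lebesgue measure.
    This imports the fundamental theorem of calculus from the real line. *)
Lemma lebesgue_time_transfer a b (h : R -> R) : continuous h ->
  \int[leb]_(s in time_segment a b) h (time_val s) =
  \int[lebesgue_measure]_(x in `[time_val a, time_val b]) h x.
Proof.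
move=> ch; congr fine.
have abE : time_segment a b = @time_val R I @^-1` `[time_val a, time_val b].
  by apply/seteqP; split => s; rewrite /time_segment/= in_itv.
have mh : measurable_fun setT h by exact: continuous_measurable_fun.
have hi : leb.-integrable (@time_val R I @^-1` `[time_val a, time_val b])
    ((EFin \o h) \o @time_val R I).
  rewrite -abE; apply: (@loc_integrable_segment a b (h \o @time_val R I)).
  apply: continuous_loc_integrable => s.
  by apply: continuous_comp; [exact: time_val_continuous|exact: ch].
have mtv : measurable_fun setT (@time_val R I : time I -> measurableTypeR R).
  exact: time_val_measurable.
have mh' : measurable_fun setT (EFin \o h : measurableTypeR R -> \bar R).
  exact/measurable_EFinP.
have mab : measurable (`[time_val a, time_val b]%classic :
  set (measurableTypeR R)).
  exact: measurable_itv.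
have pushE := integral_pushforward mtv mh' hi mab.
rewrite abE -[LHS]pushE; apply: eq_measure_integral => A mA AI.
rewrite /pushforward [LHS]lebesgue_time_measurable// setIidr//.
move=> x /AI; rewrite /= in_itv/= => xab.
by apply: (itv_setP _ _ xab); exact: set_valP.
Qed.

Lemma time_FTC a b (F : R -> R) (f : R -> R) : time_val a <= time_val b ->
  (forall x : R, is_derive x 1 F (f x)) -> continuous f ->
  \int[leb]_(s in time_segment a b) f (time_val s) = F (time_val b) - F
    (time_val a).
Proof.
move=> ab dF cf; rewrite lebesgue_time_transfer//.
have [ab'|ab'|->] := ltgtP (time_val a) (time_val b).
- rewrite /Rintegral (@continuous_FTC2 _ f F)//.
  + exact: continuous_subspaceT.
  + have cF x : {for x, continuous F}.
      by apply: differentiable_continuous; apply/derivable1_diffP; case: (dF x).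
    split; first by move=> x _; case: (dF x).
      exact: cvg_at_right_filter (cF _).
    exact: cvg_at_left_filter (cF _).
  + by move=> x _; rewrite derive1E; exact: derive_val.
- by move: ab; rewrite leNgt ab'.
- by rewrite subrr set_itv1 Rintegral_set1.
Qed.

End time_integrals.

(** * From the distributional derivative to the integral equation *)

Lemma nondecreasing_derive_ge0 (R : realType) (F f : R -> R) (x a b : R) :
  (forall y : R, is_derive y 1 F (f y)) -> a < x < b ->
  (forall y z, a < y -> y <= z -> z < b -> F y <= F z) -> 0 <= f x.
Proof.
move=> dF /andP[ax xb] Fle; rewrite leNgt; apply/negP => fx0.
(* Adding [k * y] makes the function strictly increasing, as [incr_derive1_ge0_itv] requires, while
   the derivative at [x] becomes [f x / 2], still negative. *)
pose k := - f x / 2.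
have k0 : 0 < k by rewrite divr_gt0// oppr_gt0.
pose G y := F y + k * y.
have dG (y : R) : is_derive y 1 G (f y + k).
  by apply: is_derive_eq; rewrite /GRing.scale/=; ring.
have : 0 <= derive1 G x.
  apply: (@incr_derive1_ge0_itv _ _ false true a b).
  - by move=> y _; case: (dG y).
  - move=> y z; rewrite !in_itv/= => /andP[ay yb] /andP[az zb] yz.
    by rewrite ler_ltD ?ltr_pM2l// Fle// ltW.
  - by rewrite in_itv/= ax xb.
by rewrite derive1E (@derive_val _ _ _ _ _ _ _ (dG x)) /k; lra.
Qed.

Lemma nonincreasing_derive_le0 (R : realType) (F f : R -> R) (x a b : R) :
  (forall y : R, is_derive y 1 F (f y)) -> a < x < b ->
  (forall y z, a < y -> y <= z -> z < b -> F z <= F y) -> f x <= 0.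
Proof.
move=> dF axb Fle; rewrite -oppr_ge0.
apply: (@nondecreasing_derive_ge0 _ (fun y => - F y) (fun y =>
  - f y) x a b) => //.
by move=> y z ay yz zb; rewrite lerN2 Fle.
Qed.

Section distributional_derivative.
Context {R : realType} {I : left_closed_itv R}.
Implicit Types (a b m s t : time I) (c f g : time I -> R).
Local Notation leb := (lebesgue_time I).

(** Here [sgn * f] acts as the density of a positive measure of mass [sgn * (F m - F a)]. The
    hypothesis covers two situations at once: [c] is within [e] of [k], or [f] vanishes. *)
Lemma step_integral_le a m (k e sgn : R) c (F f : R -> R) :
  time_val a <= time_val m -> continuous c -> continuous f ->
  (forall x : R, is_derive x 1 F (f x)) ->
  (forall s, time_segment a m s ->
    `|(c s - k) * f (time_val s)| <= e * (sgn * f (time_val s))) ->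
  `|\int[leb]_(s in time_segment a m) (c s * f (time_val s)) -
     k * (F (time_val m) - F (time_val a))| <=
  e * (sgn * (F (time_val m) - F (time_val a))).
Proof.
move=> am cc cf dF H.
have mS := @time_segment_measurable R I a m.
have cfv : continuous (fun s : time I => f (time_val s)).
  by move=> s; apply: continuous_comp; [exact: time_val_continuous|exact: cf].
have fi := continuous_loc_integrable cfv.
have cfi := loc_integrableM cc fi.
have ifi := loc_integrable_segment a m fi.
have icf := loc_integrable_segment a m cfi.
have ikf (r : R) : leb.-integrable (time_segment a m) (EFin \o (fun s =>
  r * f (time_val s))).
  have cr : continuous (cst r : time I -> R) by exact: cst_continuous.
  exact: loc_integrable_segment (loc_integrableM cr fi).
rewrite -(time_FTC am dF cf) -RintegralZl// -RintegralB//.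
rewrite (@eq_Rintegral _ _ _ leb _ (fun s => (c s - k) * f (time_val s)));
  last first.
  by move=> s _; rewrite mulrBl.
have cck : continuous (fun s => c s - k).
  by move=> s; exact: (cvgB (cc s) (cvg_cst _)).
have ickf : leb.-integrable (time_segment a m) (EFin \o (fun s =>
  (c s - k) * f (time_val s))).
  exact: loc_integrable_segment (loc_integrableM cck fi).
rewrite (le_trans (le_normr_Rintegral mS ickf))//.
rewrite mulrA -RintegralZl//; apply: le_Rintegral => //.
- exact: integrable_norm ickf.
- by move=> s /H; rewrite mulrA.
Qed.

(* The test functions increase to the indicator of ]a, b[, and their derivatives
   approximate the difference of the Dirac masses at a and b. *)
Lemma distr_derivative_integral c g a b : continuous c -> loc_integrable g ->
  distr_derivative c g -> time_val a <= time_val b ->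
  c b - c a = \int[leb]_(s in time_segment a b) g s.
Proof.
move=> cc gi cg; rewrite le_eqVlt => /predU1P[/time_val_inj<-|ab].
  rewrite subrr; apply/esym.
  rewrite (_ : time_segment a a = [set a]); last first.
    apply/seteqP; split => s /=; last by move=> ->;
      rewrite /time_segment/= lexx.
    by rewrite /time_segment/= => /le_anti/time_val_inj ->.
  rewrite /Rintegral (@negligible_integral _ _ _ leb [set a] [set a]) ?setDv
    ?integral_set0//.
  - exact: time_set1_measurable.
  - exact: time_set1_measurable.
  - by apply: gi; exact: compact_set1.
  - exact: lebesgue_time_set1.
set A := time_val a in ab *; set B := time_val b in ab *.
(* The divisor 8 gives the condition [4 * e n <= B - A] of [smooth_plateau] with a margin, so that
   the midpoint lies well inside every plateau. *)
pose e (n : nat) := (B - A) / 8 / n.+1%:R.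
have e0 n : 0 < e n by rewrite !divr_gt0// ?subr_gt0// ltr0n.
have eBA n : 8 * e n <= B - A.
  have -> : 8 * e n = (B - A) / n.+1%:R by rewrite /e; field.
  by rewrite ler_pdivrMr// ler_peMr ?subr_ge0 ?(ltW ab)// ler1n.
have /choice[th thP] : forall n, exists th : R -> R, [/\ smooth th,
   forall x, 0 <= th x <= 1,
   forall x, x <= A + e n \/ B - e n <= x -> th x = 0,
   forall x, A + 2 * e n <= x <= B - 2 * e n -> th x = 1 &
   (forall x y, x <= y <= B - 2 * e n -> th x <= th y) /\
   (forall x y, A + 2 * e n <= x <= y -> th y <= th x)].
  by move=> n; apply: smooth_plateau => //; have := eBA n; have := e0 n; lra.
have /choice[th' th'P] : forall n, exists th' : R -> R,
    continuous th' /\ forall x : R, is_derive x 1 (th n) (th' x).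
  move=> n; have [sth _ _ _ _] := thP n.
  have [f sf df] := smooth_derive sth; exists f; split => // x.
  have [f' _ df'] := smooth_derive sf.
  by apply: differentiable_continuous; apply/derivable1_diffP; case: (df' x).
have th'0 n x : x < A + e n \/ B - e n < x -> th' n x = 0.
  move=> xAB; have [_ dth] := th'P n; have [_ _ th0 _ _] := thP n.
  rewrite -(@derive_val _ _ _ _ _ _ _ (dth x)) -(derive_cst (0 : R) x 1).
  apply: near_eq_derive; case: xAB => xAB.
    by apply: filterS (lt_nbhsl xAB) => y /ltW yA; rewrite th0//; left.
  by apply: filterS (lt_nbhsr xAB) => y /ltW yA; rewrite th0//; right.
have test n : test_function (I := I) (th n).
  have [sth _ th0 _ _] := thP n.
  have supp : closure [set x | th n x != 0] `<=` `[A + e n, B - e n].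
    have /closure_id -> : closed (`[A + e n, B - e n]%classic : set R).
      exact: interval_closed.
    apply: closureS => x /= /negP thx; rewrite in_itv/=.
    by apply/andP; split; rewrite leNgt; apply/negP => h; apply: thx;
      rewrite th0//; [left|right]; exact: ltW.
  split.
  - exact: smooth_derivable.
  - apply: (subclosed_compact _ (@segment_compact R (A + e n) (B - e n))) => //.
    exact: closed_closure.
  - move=> x /supp; rewrite /= in_itv/= => /andP[Ax xB].
    apply: (@filterS _ _ _ `]A, B[%classic).
      move=> y; rewrite /= in_itv/= => /andP[/ltW Ay /ltW yB].
      by apply: (itv_setP (set_valP a) (set_valP b)); rewrite Ay yB.
    apply: open_nbhs_nbhs; split; first exact: interval_open.
    by rewrite /= in_itv/=; have := e0 n; lra.
pose u n := \int[leb]_(s in time_segment a b) (c s * th' n (time_val s)).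
pose v n := \int[leb]_(s in time_segment a b) (th n (time_val s) * g s).
have restr (h : time I -> R) :
    (forall s, ~ time_segment a b s -> h s = 0) ->
    \int[leb]_s h s = \int[leb]_(s in time_segment a b) h s.
  move=> h0; rewrite [RHS]Rintegral_mkcond; apply: eq_Rintegral => s _.
  by rewrite patchE; case: ifPn => //; rewrite notin_setE => /h0.
have out n s : ~ time_segment a b s ->
    time_val s < A + e n \/ B - e n < time_val s.
  move=> abs; have := e0 n; case: (ltP (time_val s) A) => sA en;
    first by left; lra.
  right; case: (ltP B (time_val s)) => sB; first lra.
  by exfalso; apply: abs; rewrite /time_segment/= sA.
have uv n : u n = - v n.
  have [_ _ th0 _ _] := thP n; have [_ dth] := th'P n.
  have := cg _ (test n); rewrite !restr.
  - rewrite /u /v => h; transitivity (- \int[leb]_(s in time_segment a b) (g s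
      * th n (time_val s))).
      rewrite -h; apply: eq_Rintegral => s _; rewrite derive1E.
      by rewrite (@derive_val _ _ _ _ _ _ _ (dth _)).
    by congr (- _); apply: eq_Rintegral => s _; rewrite mulrC.
  - by move=> s /(out n) h; rewrite th0 ?mulr0//; case: h => /ltW; [left|right].
  - move=> s /(out n) h; rewrite derive1E (@derive_val _ _ _ _ _ _ _ (dth _)).
    by rewrite th'0 ?mulr0.
(* At the midpoint the test functions equal 1. Before it their derivatives are nonnegative of
   integral 1, after it nonpositive of integral -1. *)
have [m mE] : exists m : time I, time_val m = (A + B) / 2.
  by apply: (@time_between _ _ a b); rewrite -/A -/B; apply/andP; split; lra.
have ecvg : e @ \oo --> 0.
  rewrite -(mulr0 ((B - A) / 8)); apply: cvgM; first exact: cvg_cst.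
  exact: cvg_harmonic.
have ucvg : u @ \oo --> c a - c b.
  apply/cvgrPdist_le => r r0.
  have r20 : 0 < r / 2 by rewrite divr_gt0.
  have near_c t : exists2 d : R, 0 < d &
      forall s, `|time_val s - time_val t| < d -> `|c s - c t| <= r / 2.
    have /cvgrPdist_le/(_ _ r20)/nbhs_timeP[d d0 dc] := cc t.
    by exists d => // s /dc; rewrite distrC.
  have [da da0 hda] := near_c a; have [db db0 hdb] := near_c b.
  (* With [3 * e n] below both radii, the transition zones, of extent [2 * e n] from the ends, stay
     where [c] is within [r / 2] of its end values. *)
  have dm0 : 0 < Num.min da db / 3 by rewrite divr_gt0// lt_min da0.
  have /cvgrPdist_lt/(_ _ dm0) := ecvg; apply: filterS => n.
  rewrite sub0r normrN gtr0_norm// ltr_pdivlMr// lt_min => /andP[eda edb].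
  have [cf df] := th'P n; have [_ _ th0 th1 [thle thge]] := thP n.
  have en := e0 n; have eABn := eBA n.
  have ge0 (x : R) : x < B - 2 * e n -> 0 <= th' n x.
    move=> xB; apply: (nondecreasing_derive_ge0 (a := x - 1) (b :=
      B - 2 * e n) df).
      by rewrite xB andbT ltrBlDr ltrDl.
    by move=> y z _ yz zB; rewrite thle// yz ltW.
  have le0 (x : R) : A + 2 * e n < x -> th' n x <= 0.
    move=> Ax; apply: (nonincreasing_derive_le0 (a := A + 2 * e n) (b :=
      x + 1) df).
      by rewrite Ax/= ltrDl.
    by move=> y z Ay yz _; rewrite thge// yz ltW.
  have eq0 (x : R) : A + 2 * e n < x -> x < B - 2 * e n -> th' n x = 0.
    by move=> Ax xB; apply: le_anti; rewrite le0// ge0.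
  have am : time_val a <= time_val m by rewrite -/A mE; lra.
  have mb : time_val m <= time_val b by rewrite -/B mE; lra.
  have H1 := @step_integral_le a m (c a) (r / 2) 1 c (th n) (th' n) am cc cf df.
  have H2 := @step_integral_le m b (c b) (r / 2) (-1) c (th n) (th' n) mb cc cf
    df.
  have cfi : leb.-integrable (time_segment a b)
      (EFin \o (fun s => c s * th' n (time_val s))).
    apply: loc_integrable_segment; apply: loc_integrableM => //.
    apply: continuous_loc_integrable => s.
    by apply: continuous_comp; [exact: time_val_continuous|exact: cf].
  rewrite /u (time_integral_split am mb cfi).
  have {}H1 : `|\int[leb]_(s in time_segment a m) (c s * th' n (time_val s)) -
    c a| <= r / 2.
    move: H1; rewrite (th1 (time_val m)) ?(th0 (time_val a)).
    - rewrite subr0 !mulr1; apply => s /andP[as_ sm]; rewrite mE in sm.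
      have th's : 0 <= th' n (time_val s) by apply: ge0; lra.
      rewrite mul1r normrM (ger0_norm th's).
      have [sA|As] := leP (time_val s) (A + 2 * e n).
        rewrite ler_wpM2r// hda// ger0_norm ?subr_ge0// -/A; lra.
      by rewrite eq0 ?mulr0//; lra.
    - by left; rewrite -/A; lra.
    - by rewrite mE; apply/andP; split; lra.
  have {}H2 : `|\int[leb]_(s in time_segment m b) (c s * th' n (time_val s)) +
    c b| <= r / 2.
    move: H2; rewrite (th1 (time_val m)) ?(th0 (time_val b)).
    - rewrite sub0r mulrN1 opprK mulN1r opprK mulr1; apply => s /andP[ms sb].
      rewrite mE in ms.
      have th's : th' n (time_val s) <= 0 by apply: le0; lra.
      rewrite mulN1r normrM (ler0_norm th's).
      have [sB|Bs] := leP (B - 2 * e n) (time_val s).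
        rewrite ler_wpM2r ?oppr_ge0// hdb// ler0_norm ?subr_le0// opprB -/B;
          lra.
      by rewrite eq0 ?oppr0 ?mulr0//; lra.
    - by right; rewrite -/B; lra.
    - by rewrite mE; apply/andP; split; lra.
  move: H1 H2; rewrite !ler_norml => /andP[? ?] /andP[? ?].
  by apply/andP; split; lra.
have vcvg : v @ \oo --> \int[leb]_(s in time_segment a b) g s.
  have ig := loc_integrable_segment a b gi.
  have mg : measurable_fun (time_segment a b) g.
    exact/measurable_EFinP/(measurable_int leb).
  apply: (@Rintegral_dominated_cvg _ _ _ leb (time_segment a b)
    (fun n s => th n (time_val s) * g s) g (fun s => `|g s|)).
  - exact: time_segment_measurable.
  - move=> n; apply: measurable_funM; last exact: mg.
    apply/measurable_funTS/continuous_time_measurable => s.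
    have [_ dth] := th'P n.
    apply: continuous_comp; first exact: time_val_continuous.
    by apply: differentiable_continuous; apply/derivable1_diffP;
      case: (dth (time_val s)).
  - exact: mg.
  (* At the two end points the test functions vanish for all [n]; at any other point of the segment
     they equal 1 once [2 * e n] is below the distance to both ends. *)
  - exists ([set a] `|` [set b]); split.
    + by apply: measurableU; exact: time_set1_measurable.
    + apply: null_set_setU; try exact: time_set1_measurable.
        exact: lebesgue_time_set1.
      exact: lebesgue_time_set1.
    + move=> s /= ns; have [->|sa] := pselect (s = a); first by left.
      have [->|sb] := pselect (s = b); first by right.
      exfalso; apply: ns => /andP[as_ sb_]; rewrite -[X in _ --> X]mul1r.
      apply: cvgM; last exact: cvg_cst.
      have As : A < time_val s.
        by rewrite lt_neqAle as_ andbT; apply/eqP => /time_val_inj/esym.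
      have sB : time_val s < B.
        by rewrite lt_neqAle sb_ andbT; apply/eqP => /time_val_inj.
      have dm0 : 0 < Num.min (time_val s - A) (B - time_val s) / 2.
        by rewrite divr_gt0// lt_min !subr_gt0 As.
      have /cvgrPdist_lt/(_ _ dm0) := ecvg.
      move=> h; apply: cvg_near_cst; apply: filterS h => n.
      rewrite sub0r normrN gtr0_norm// ltr_pdivlMr// lt_min => /andP[eA eB].
      have [_ _ _ th1 _] := thP n; apply: th1.
      by apply/andP; split; lra.
  - exact: integrable_norm.
  - move=> n s _; have [_ th01 _ _ _] := thP n.
    have /andP[t0 t1] := th01 (time_val s).
    by rewrite normrM ger0_norm// ler_piMl.
have : - v @ \oo --> c a - c b.
  by have -> : - v = u by apply/funext => n; rewrite uv.
move/cvgN; rewrite opprK opprB => vcvg'.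
exact: (cvg_unique (@Rhausdorff R) vcvg' vcvg).
Qed.

End distributional_derivative.

(** * The chain rule along trajectories *)

Section row_calculus.
Context {R : realType} {k : nat}.
Implicit Types (phi : 'rV[R]_k -> R) (p q : 'rV[R]_k).

Lemma row_nbhsP p (A : set 'rV[R]_k) : nbhs p A <->
  exists2 e : R, 0 < e & forall q, (forall j, `|q ord0 j - p ord0 j| < e) ->
    A q.
Proof.
split=> [/nbhs_ballP[e /= e0 eA]|[e e0 eA]].
  exists e => // q pq; apply: eA; split => // i j.
  by rewrite ord1 -ball_normE/= distrC.
apply/nbhs_ballP; exists e => //= q [_ pq]; apply: eA => j.
by have := pq ord0 j; rewrite -ball_normE/= distrC.
Qed.

Lemma continuous_row (T : topologicalType) (f : T -> 'rV[R]_k) :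
  (forall j, continuous (fun t => f t ord0 j)) -> continuous f.
Proof.
move=> cf t A /row_nbhsP[e e0 eA].
have : \forall s \near t, forall j, `|f s ord0 j - f t ord0 j| < e.
  apply: filter_forall => j; have /cvgrPdist_lt/(_ _ e0) := cf j t.
  by apply: filterS => s; rewrite distrC.
by apply: filterS => s; exact: eA.
Qed.

Lemma derive_row_sum phi p (h : 'rV[R]_k) : differentiable phi p ->
  'D_h phi p = \sum_j h ord0 j * 'D_(delta_mx 0 j) phi p.
Proof.
move=> dphi; rewrite deriveE// {1}(row_sum_delta h) linear_sum.
by apply: eq_bigr => j _; rewrite linearZ/= deriveE.
Qed.

(** One intermediate point serves all coordinates, which lets [chain_rule_integral] freeze the
    partial derivatives over a whole time interval. *)
Lemma row_mean_value phi p q : (forall x, differentiable phi x) ->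
  exists2 r : R, 0 < r < 1 &
    phi q - phi p = \sum_j (q ord0 j - p ord0 j) *
      'D_(delta_mx 0 j) phi (p + r *: (q - p)).
Proof.
move=> dphi; pose psi (r : R) := phi (p + r *: (q - p)).
have dpsi (r : R) : is_derive r 1 psi ('D_(q - p) phi (p + r *: (q - p))).
  have E : (fun h : R => h^-1 *: ((psi \o shift r) (h *: (1 : R)) - psi r)) =
      fun h => h^-1 *: ((phi \o shift (p + r *: (q - p))) (h *: (q - p))
                        - phi (p + r *: (q - p))).
    apply/funext => h; congr (_ *: (_ - _)); rewrite /= /psi; congr phi.
    have -> : h *: (1 : R) = h by rewrite /GRing.scale/= mulr1.
    by rewrite scalerDl addrCA.
  have := @diff_derivable _ _ _ phi (p + r *: (q - p)) (q - p) (dphi _).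
  by rewrite /derivable -E => dp; constructor => //; rewrite /derive -E.
have [|r r01 psiE] := @MVT R psi (fun r =>
  'D_(q - p) phi (p + r *: (q - p))) 0 1 ltr01 (fun r _ => dpsi r).
  apply: continuous_subspaceT => r; apply: differentiable_continuous.
  by apply/derivable1_diffP; case: (dpsi r).
exists r; first by move: r01; rewrite in_itv.
move: psiE; rewrite /psi scale1r scale0r addr0 subrKC subr0 mulr1 => ->.
rewrite derive_row_sum//; apply: eq_bigr => j _.
by rewrite !mxE.
Qed.

End row_calculus.

Section chain_rule.
Context {R : realType} {I : left_closed_itv R}.
Implicit Types (a b m s t : time I) (H g : time I -> R).
Local Notation leb := (lebesgue_time I).

(** The local estimates add up along [a, b] by a supremum argument, so the increment of [H] is at
    most [e * (m b - m a)] for every [e]. The gauge [m] is kept general: for integrands that are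
    merely integrable, errors are small relative to an integral, not to the elapsed time. The
    estimate is asked only for intervals around [t]. *)
Lemma time_local_to_global a b H (m : time I -> R) : time_val a <= time_val b ->
  (forall e : R, 0 < e -> forall t, time_segment a b t -> exists2 d : R, 0 < d &
    forall x y, time_segment a b x -> time_segment a b y ->
      time_val x <= time_val t <= time_val y ->
      `|time_val x - time_val t| < d -> `|time_val y - time_val t| < d ->
      `|H y - H x| <= e * (m y - m x)) ->
  H b = H a.
Proof.
move=> ab loc.
have key (e : R) : 0 < e -> `|H b - H a| <= e * (m b - m a).
  move=> e0.
  pose S := [set x : R | exists s, [/\ time_segment a b s, time_val s = x &
     `|H s - H a| <= e * (m s - m a)]].
  have Sa : S (time_val a).
    by exists a; split; rewrite /time_segment/= ?lexx// !subrr normr0 mulr0.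
  have Sb : ubound S (time_val b) by move=> _ [s [/andP[_ sb] <- _]].
  have hS : has_sup S by split; [exists (time_val a)|exists (time_val b)].
  have az : time_val a <= sup S by apply: ub_le_sup => //; exists (time_val b).
  have zb : sup S <= time_val b by apply: ge_sup => //; exists (time_val a).
  have [t tz] : exists t : time I, time_val t = sup S.
    by apply: (@time_between _ _ a b); rewrite az zb.
  have abt : time_segment a b t by rewrite /time_segment/= tz az zb.
  have [d d0 hd] := loc e e0 t abt.
  have [_ [s [abs <- hs]] zs] := sup_adherent d0 hS.
  have sz : time_val s <= sup S by apply: ub_le_sup;
    [exists (time_val b)|exists s].
  (* The interval from [s], a point of [S] just before the supremum, to [y] contains [t], so the
     local estimate extends the bound from [s] to [y]. *)
  have ext y : time_segment a b y -> sup S <= time_val y < sup S + d ->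
      `|H y - H a| <= e * (m y - m a).
    move=> aby /andP[zy yzd].
    have -> : m y - m a = (m y - m s) + (m s - m a) by ring.
    rewrite -(subrK (H s) (H y)) -addrA mulrDr (le_trans (ler_normD _ _))//
      lerD//.
    apply: hd => //; rewrite tz ?sz ?zy//; first by rewrite ltr_norml; lra.
    by rewrite ltr_norml; lra.
  (* A point beyond the supremum unless [b] comes first; since it belongs to [S], [b] must come
     first. *)
  have [y yE] : exists y : time I,
    time_val y = Num.min (time_val b) (sup S + d / 2).
    apply: (@time_between _ _ a b); rewrite ge_min lexx/= andbT le_min ab/=;
      lra.
  have aby : time_segment a b y.
    rewrite /time_segment/= yE ge_min lexx/= andbT le_min ab/=; lra.
  have yz : time_val y <= sup S.
    apply: ub_le_sup; first by exists (time_val b).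
    exists y; split => //; apply: ext => //.
    by rewrite yE le_min zb gt_min; apply/andP; split; [lra|apply/orP; right;
      lra].
  have bz : time_val b <= sup S.
    by move: yz; rewrite yE ge_min => /orP[//|]; lra.
  apply: ext; first by rewrite /time_segment/= ab lexx.
  by rewrite zb/=; lra.
apply/eqP; rewrite -subr_eq0 -normr_le0; apply/ler_addgt0Pr => e e0;
  rewrite add0r.
have M0 : 0 <= m b - m a by have := key 1 ltr01; rewrite mul1r; apply: le_trans.
(* The added 1 avoids a division by zero when [m] does not grow. *)
rewrite (le_trans (key (e / (m b - m a + 1)) _))//.
  by rewrite divr_gt0//; lra.
rewrite mulrAC ler_pdivrMr; last lra.
by rewrite ler_pM2l//; lra.
Qed.

(** [time_local_to_global] is applied to [phi] along the path minus the integral of [G], with the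
    integral of the sum of the [|g j|] as gauge. On a short interval the increment of [phi] is the
    integral of the field against partial derivatives frozen at one point, and unfreezing them costs
    at most [e] times the gauge. *)
Lemma chain_rule_integral k (phi : 'rV[R]_k -> R) (c g :
  'I_k -> time I -> R) a b :
  (forall x, differentiable phi x) ->
  (forall j, continuous (fun x => 'D_(delta_mx 0 j) phi x)) ->
  (forall j, continuous (c j)) -> (forall j, loc_integrable (g j)) ->
  (forall j s t, time_val s <= time_val t ->
    c j t - c j s = \int[leb]_(r in time_segment s t) g j r) ->
  time_val a <= time_val b ->
  let G s := \sum_j 'D_(delta_mx 0 j) phi (\row_i c i s) * g j s in
  loc_integrable G /\
  phi (\row_j c j b) - phi (\row_j c j a) = \int[leb]_(s in time_segment a b) G
    s.
Proof.
move=> dphi cphi cc gi cg ab G.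
have crow : continuous (fun s => \row_j c j s : 'rV[R]_k).
  apply: continuous_row => j; rewrite (_ : (fun t => _) = c j)//.
  by apply/funext => s; rewrite mxE.
have cDphi j : continuous (fun s => 'D_(delta_mx 0 j) phi (\row_i c i s)).
  by move=> s; exact: (continuous_comp (crow s) (cphi j _)).
have loc_sum (h : 'I_k -> time I -> R) : (forall j, loc_integrable (h j)) ->
    loc_integrable (fun s => \sum_j h j s).
  move=> hi K cK; have mK := compact_time_measurable cK.
  rewrite (_ : _ \o _ = fun s => (\sum_j (h j s)%:E)%E); last first.
    by apply/funext => s /=; rewrite sumEFin.
  by apply: integrable_sum => // j _; exact: hi.
have Gi : loc_integrable G.
  by apply: loc_sum => j; exact: loc_integrableM.
split => //.
pose W s := \sum_j `|g j s|.
have Wi : loc_integrable W by apply: loc_sum => j; exact: loc_integrable_norm.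
pose P h t := \int[leb]_(s in time_segment a t) h s.
have PB h x y : loc_integrable h -> time_val a <= time_val x ->
  time_val x <= time_val y ->
    P h y - P h x = \int[leb]_(s in time_segment x y) h s.
  move=> hi ax xy; rewrite /P (time_integral_split ax xy);
    last exact: loc_integrable_segment.
  by rewrite addrC addKr.
have P0 h : loc_integrable h -> P h a = 0.
  move=> hi; have := PB h a a hi (lexx _) (lexx _); rewrite subrr => h0.
  by rewrite /P -h0.
suff : phi (\row_j c j b) - P G b = phi (\row_j c j a) - P G a.
  by rewrite (P0 _ Gi) /P; lra.
apply: (@time_local_to_global a b (fun t =>
  phi (\row_j c j t) - P G t) (P W)) => //.
move=> e e0 t abt.
have e20 : 0 < e / 2 by rewrite divr_gt0.
have [r r0 hr] : exists2 r : R, 0 < r & forall p : 'rV[R]_k,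
    (forall j, `|p ord0 j - c j t| < r) ->
    forall j, `|'D_(delta_mx 0 j) phi p - 'D_(delta_mx 0 j) phi (\row_i c i t)|
      <= e / 2.
  pose p0 : 'rV[R]_k := \row_i c i t.
  have nb j : nbhs p0 (fun p : 'rV[R]_k =>
      `|'D_(delta_mx 0 j) phi p - 'D_(delta_mx 0 j) phi p0| <= e / 2).
    have /cvgrPdist_le/(_ _ e20) := cphi j p0.
    by apply: filterS => p; rewrite distrC.
  have nball := @filter_forall _ _ _ (nbhs p0) (nbhs_filter p0) nb.
  have [r r0 hr] := (row_nbhsP p0 _).1 nball.
  by exists r => // p hp; apply: hr => j; rewrite mxE.
have [d d0 hd] : exists2 d :
  R, 0 < d & forall s, `|time_val s - time_val t| < d ->
    forall j, `|c j s - c j t| < r.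
  have nb j : nbhs t (fun s => `|c j s - c j t| < r).
    have /cvgrPdist_lt/(_ _ r0) := cc j t.
    by apply: filterS => s; rewrite distrC.
  have nball := @filter_forall _ _ _ (nbhs t) (nbhs_filter t) nb.
  have [d d0 hd] := (nbhs_timeP t _).1 nball.
  by exists d.
exists d => // x y /andP[ax xb] /andP[ay yb] /andP[xt ty] xd yd.
have xy := le_trans xt ty.
have [l l01 phiE] := row_mean_value (\row_j c j x) (\row_j c j y) dphi.
(* A convex combination of the positions at [x] and [y], so each coordinate stays within [r] of its
   value at [t]. *)
set xi := \row_j c j x + _ in phiE.
have hxi j : `|xi ord0 j - c j t| < r.
  have := hd x xd j; have := hd y yd j; rewrite !ltr_norml /xi !mxE.
  move: l01 => /andP[l0 l1] /andP[y1 y2] /andP[x1 x2].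
  by apply/andP; split; nra.
have mS := @time_segment_measurable R I x y.
have iS h : loc_integrable h -> leb.-integrable (time_segment x y) (EFin \o h).
  exact: loc_integrable_segment.
(* [G] with the partial derivatives frozen at [xi]; its integral is exactly the increment of
   [phi]. *)
pose K s := \sum_j 'D_(delta_mx 0 j) phi xi * g j s.
have Ki : loc_integrable K.
  by apply: loc_sum => j; apply: loc_integrableM => //; exact: cst_continuous.
have phiE' : phi (\row_j c j y) - phi (\row_j c j x) = \int[leb]_(s in
  time_segment x y) K s.
  rewrite phiE /Rintegral.
  rewrite (_ : (\int[leb]_(s in time_segment x y) (K s)%:E)%E =
      (\sum_j ('D_(delta_mx 0 j) phi xi * (c j y - c j x))%:E)%E); last first.
    transitivity (\int[leb]_(s in time_segment x y)
        (\sum_j ('D_(delta_mx 0 j) phi xi * g j s)%:E))%E.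
      by apply: eq_integral => s _; rewrite /K sumEFin.
    rewrite integral_sum//; last first.
      by move=> j; apply: iS; apply: loc_integrableM => //;
        exact: cst_continuous.
    apply: eq_bigr => j _; rewrite cg// -RintegralZl//; last exact: iS.
    rewrite fineK//; apply: integrable_fin_num => //.
    by apply: iS; apply: loc_integrableM => //; exact: cst_continuous.
  rewrite sumEFin/=; apply: eq_bigr => j _; by rewrite !mxE mulrC.
have -> : phi (\row_j c j y) - P G y - (phi (\row_j c j x) - P G x) =
    \int[leb]_(s in time_segment x y) (K s - G s).
  rewrite (@RintegralB _ _ _ leb)//; [|exact: iS|exact: iS].
  by rewrite -phiE' -(PB G)//; ring.
rewrite PB// -RintegralZl//; last exact: iS.
have iKG : leb.-integrable (time_segment x y) (EFin \o (fun s => K s - G s)).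
  exact: integrableB (iS _ Ki) (iS _ Gi).
rewrite (le_trans (le_normr_Rintegral mS iKG))//.
apply: le_Rintegral => //.
- exact: integrable_norm iKG.
- apply: iS; apply: loc_integrableM => //; exact: cst_continuous.
(* The partial derivatives at [xi] and at the position at time [s] both differ by at most [e / 2]
   from those at time [t]. *)
move=> s /andP[xs sy]; rewrite /K /G /W -sumrB mulr_sumr.
rewrite (le_trans (ler_norm_sum _ _ _))//; apply: ler_sum => j _.
rewrite -mulrBl normrM ler_wpM2r//.
have hs : forall i, `|(\row_i c i s) ord0 i - c i t| < r.
  move=> i; rewrite mxE; apply: hd; move: xd yd; rewrite !ltr_norml.
  by move=> /andP[? ?] /andP[? ?]; apply/andP; split; lra.
have := hr _ hs j; have := hr _ hxi j; rewrite !ler_norml.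
by move=> /andP[? ?] /andP[? ?]; apply/andP; split; lra.
Qed.

End chain_rule.

(** * Measurability of the vector field *)

Section dual_evaluation.
Context {R : realType} {Y : topologicalLmodType R}.

(** Continuity of the scalar multiplication at 0 puts [a^-1 *: v] in [V] for large [a]. Uniform
    convergence on bounded sets thus includes convergence at each point. *)
Lemma tvs_bounded_set1 (v : Y) : tvs_bounded [set v].
Proof.
move=> V V0.
have cv : {for 0 : R^o, continuous (fun r : R^o => r *: v)}.
  apply: (@continuous_comp R^o (R^o * Y)%type Y (fun r => (r, v))
    (fun z => z.1 *: z.2)); last exact: scale_continuous.
  by apply: (@cvg_pair _ _ _ _ (nbhs (0 : R^o)));
    [exact: cvg_id|exact: cvg_cst].
have : nbhs (0 : R^o) [set r : R^o | V (r *: v)].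
  by apply: cv; rewrite /= scale0r.
(* The numerator 2 instead of 1 makes the inverse of [a] strictly smaller than [d]. *)
move=> /nbhs_ballP[d /= d0 dV]; exists (2 / d) => a da _ ->.
have an0 : a != 0.
  apply/eqP => a0; move: da; rewrite a0 normr0 leNgt divr_gt0//.
exists (a^-1 *: v); last by rewrite scalerA divff// scale1r.
apply: dV; rewrite -ball_normE/= sub0r normrN normfV.
rewrite invf_plt ?posrE ?normr_gt0//.
by apply: lt_le_trans da; rewrite ltr_pdivlMr// mulVf ?gt_eqF// ltr1n.
Qed.

(** The topology of uniform convergence on the bounded set [[set v]] is that of convergence at [v].
    Through this lemma the strong Borel measurability of [F] yields that of its scalar
    components. *)
Lemma strong_dual_eval_continuous (v : Y) :
  continuous (fun f : strong_dual Y => (f : topdual Y) v).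
Proof.
move=> f.
pose ev (f : strong_dual Y) :=
  ((f : topdual Y) : Y -> R) : {family @tvs_bounded R Y, Y -> R}.
have cev : (ev @ nbhs f : set_system _) --> ev f by exact: initial_continuous.
have FF : Filter (ev @ nbhs f) by exact: (fmap_filter ev (nbhs_filter f)).
have := (fam_cvgP (@tvs_bounded R Y) (ev f) FF).1 cev _ (tvs_bounded_set1 v).
by rewrite (uniform_set1 _ _ FF).
Qed.

Lemma weak_star_eval_continuous (v : Y) :
  continuous (fun f : weak_star Y => (f : topdual Y) v).
Proof.
move=> f.
apply: (@continuous_comp (weak_star Y) {ptws Y -> R} R
  (fun f => (f : topdual Y) : Y -> R) (fun g => g v)).
  exact: initial_continuous.
exact: (@proj_continuous Y (fun=> R) v).
Qed.

End dual_evaluation.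

Section injection_measurable.
Context {R : realType} {I : left_closed_itv R} {X Z : ptopologicalType}.
Variable iZX : Z -> X.
Hypothesis iZX_inj : injective iZX.
Hypothesis H4 : forall B : set (borel Z), measurable B ->
  measurable (iZX @` B : set (borel X)).

Let inj (p : time I * Z) : time I * X := (p.1, iZX p.2).

(** [H4] concerns [Z] alone. The sets with measurable image contain the rectangles and form a
    sigma-algebra: for complements, [inj] is injective and its range is measurable. *)
Lemma injection_measurable (B : set (time I * borel Z)) : measurable B ->
  measurable (inj @` B : set (time I * borel X)).
Proof.
have injI : injective inj by move=> [s z] [s' z'];
  rewrite /inj/= => -[-> /iZX_inj ->].
rewrite measurable_prod_measurableType.
apply: (@smallest_sub _ (sigma_algebra setT) _
  [set C : set (time I * borel Z) | measurable (inj @` C :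
    set (time I * borel X))]).
  split=> [|C mC|C mC].
  - by rewrite /= image_set0; exact: measurable0.
  - rewrite /=; have -> : inj @` (setT `\` C) = (setT `*` range iZX) `\` (inj
      @` C).
      apply/seteqP; split=> [_ [[s z] [_ nC] <-]|[s x] [/= [_ [z _ zx]] nC]].
        split=> /=; first by split => //; exists z.
        by move=> [q Cq] /injI qE; apply: nC; rewrite -qE.
      exists (s, z); last by rewrite /inj/= zx.
      by split => // Csz; apply: nC; exists (s, z) => //; rewrite /inj/= zx.
    apply: measurableD => //; apply: measurableX => //.
    exact: H4.
  - by rewrite /= image_bigcup; exact: bigcupT_measurable.
move=> _ [A mA [B' mB' <-]]; rewrite /=.
have -> : inj @` (A `*` B') = A `*` (iZX @` B').
  apply/seteqP; split=> [_ [[s z] [As Bz] <-]|[s x] [/= As [z Bz zx]]].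
    by split => //=; exists z.
  by exists (s, z) => //; rewrite /inj/= zx.
by apply: measurableX => //; exact: H4.
Qed.

Lemma inZ_measurable : measurable (inZ iZX : set (borel X)).
Proof. exact: H4. Qed.

Context {Y : topologicalLmodType R} {F : time I * Z -> topdual Y}.
Hypothesis H5_meas : measurable_fun setT
     (F : time I * borel Z -> borel (strong_dual Y)).

Lemma pairF_in t z v : pairF iZX F t (iZX z) v = F (t, z) v.
Proof.
rewrite /pairF patchE mem_set; last by exists z.
suff -> : get [set z0 | iZX z0 = iZX z] = z by [].
by apply: iZX_inj; apply: (getPex (P := [set z0 | iZX z0 = iZX z])); exists z.
Qed.

Lemma pairF_out t x v : ~ inZ iZX x -> pairF iZX F t x v = 0.
Proof. by move=> nx; rewrite /pairF patchE memNset. Qed.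

Lemma pairF_measurable v :
  measurable_fun setT (fun p : time I * borel X => pairF iZX F p.1 p.2 v).
Proof.
apply: measurable_fun_open => G oG.
have mF : measurable [set p : time I * borel Z | G (F p v)].
  pose E : set (borel (strong_dual Y)) := [set f | G ((f : topdual Y) v)].
  have mE : measurable E.
    apply: sub_sigma_algebra; apply: (@open_comp _ _ (fun f :
      strong_dual Y => (f : topdual Y) v)) => //.
    by move=> f _; exact: strong_dual_eval_continuous.
  by have := H5_meas measurableT mE; rewrite setTI.
(* Off [Z] the extended pairing is 0, so the part of the preimage outside [Z] is everything or
   nothing, according to whether [G] contains 0. *)
have -> : (fun p : time I * borel X => pairF iZX F p.1 p.2 v) @^-1` G =
   (inj @` [set p : time I * borel Z | G (F p v)]) `|`
   (if pselect (G 0) then setT `*` ~` inZ iZX else set0).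
  apply/seteqP; split=> [[t x] /= Gp|[t x]].
    have [[z _ zx]|nx] := pselect (inZ iZX x).
      left; exists (t, z); last by rewrite /inj/= zx.
      by move: Gp; rewrite -zx pairF_in.
    right; move: Gp; rewrite pairF_out//; case: pselect => //.
  case=> [[[s z] /= Gp [<- <-]]|]; first by rewrite pairF_in.
  by case: pselect => // G0 [_ nx]; rewrite /= pairF_out.
apply: measurableU; first exact: injection_measurable.
case: pselect => [G0|G0] /=; last exact: measurable0.
apply: measurableX => //.
by apply: measurableC; exact: inZ_measurable.
Qed.

End injection_measurable.

(** * Exchanging the integrals *)

Section integrable_fine.
Context d (T : measurableType d) (R : realType).
Variables (mu : {measure set T -> \bar R}) (D : set T) (F : T -> \bar R).
Hypotheses (mD : measurable D) (iF : mu.-integrable D F).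

Lemma measurable_fine_integrable : measurable_fun D (fun x => fine (F x)).
Proof.
by apply: measurableT_comp (measurable_int mu iF); exact: fine_measurable.
Qed.

(** In an iterated integral some inner integrals may be infinite. For an integrable function this
    happens on a null set, where [fine] substitutes 0 without changing the outer integral. *)
Lemma integrable_fine : mu.-integrable D (fun x => (fine (F x))%:E).
Proof.
apply: le_integrable iF => //.
  exact/measurable_EFinP/measurable_fine_integrable.
by move=> x Dx; case: (F x) => [r| |] //=; rewrite ?normr0 ?leey.
Qed.

Lemma Rintegral_fine : \int[mu]_(x in D) fine (F x) = fine (\int[mu]_(x in D) F
  x).
Proof.
congr fine; apply: ae_eq_integral => //.
- exact/measurable_EFinP/measurable_fine_integrable.
- exact: measurable_int iF.
by apply: filterS (integrable_ae mD iF) => x h /h; exact: fineK.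
Qed.

End integrable_fine.

Section restricted_fubini.
Context d1 d2 (T1 : measurableType d1) (T2 : measurableType d2) (R : realType).
Variables (m1 : {sigma_finite_measure set T1 -> \bar R})
  (m2 : {sigma_finite_measure set T2 -> \bar R}) (A : set T1) (f :
    T1 * T2 -> R).
Hypotheses (mA : measurable A)
  (fi : (m1 \x m2)%E.-integrable (A `*` setT) (EFin \o f)).

Let fA := (EFin \o f) \_ (A `*` setT).

Let mAT : measurable (A `*` [set: T2]).
Proof. exact: measurableX. Qed.

Let fAi : (m1 \x m2)%E.-integrable setT fA.
Proof. by rewrite /fA -integrable_mkcond. Qed.

Let fA_in x y : A x -> fA (x, y) = (f (x, y))%:E.
Proof. by move=> Ax; rewrite /fA patchE mem_set. Qed.

Let fA_r y : (fun x => fA (x, y)) = (fun x => (f (x, y))%:E) \_ A.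
Proof.
apply/funext => x; rewrite /fA !patchE; have [xA|xA] := boolP (x \in A).
  by rewrite mem_set//; split => //; rewrite inE in xA.
by rewrite memNset// => -[Ax _]; rewrite notin_setE in xA.
Qed.

Let F_in x : A x -> fubini_F m2 fA x = (\int[m2]_y (f (x, y))%:E)%E.
Proof. by move=> Ax; apply: eq_integral => y _; exact: fA_in. Qed.

Lemma ae_integrable_section :
  {ae m1, forall x, A x -> m2.-integrable setT (fun y => (f (x, y))%:E)}.
Proof.
apply: filterS (ae_integrable1 fAi) => x + Ax.
by apply: eq_integrable => // y _; rewrite fA_in.
Qed.

Lemma integrable_Rintegral_section :
  m1.-integrable A (fun x => (\int[m2]_y f (x, y))%:E).
Proof.
have iF : m1.-integrable A (fubini_F m2 fA).
  by apply: integrableS (integrable_fubini_F fAi).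
apply: eq_integrable (integrable_fine mA iF) => // x; rewrite inE => Ax.
by rewrite F_in.
Qed.

Let iG : m2.-integrable setT (fubini_G m1 fA).
Proof.
apply/integrableP; split; first exact: (measurable_fubini_G fAi).
have mfA := measurable_int _ fAi.
have mabs : measurable_fun setT (abse \o fA) by exact: measurableT_comp.
apply: (@le_lt_trans _ _ (\int[m2]_y \int[m1]_x `|fA (x, y)|)%E); last first.
  by apply/(integrable21ltyP m1 m2 mfA); exact: fAi.
apply: ge0_le_integral => //.
- by apply: measurableT_comp => //; exact: (measurable_fubini_G fAi).
- exact: (measurable_fun_fubini_tonelli_G (abse \o fA) mabs (fun=> abse_ge0 _)).
- move=> y _; apply: le_abse_integral => //.
  exact: measurableT_comp mfA (pair2_measurable y).
Qed.

Let fG_r y : fubini_G m1 fA y = (\int[m1]_(x in A) (f (x, y))%:E)%E.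
Proof. by rewrite /fubini_G fA_r -integral_mkcond. Qed.

Lemma integrable_Rintegral_section_r :
  m2.-integrable setT (fun y => (\int[m1]_(x in A) f (x, y))%:E).
Proof.
apply: eq_integrable (integrable_fine measurableT iG) => // y _.
by rewrite fG_r.
Qed.

Lemma Rintegral_fubini :
  \int[m1]_(x in A) (\int[m2]_y f (x,
    y)) = \int[m2]_y (\int[m1]_(x in A) f (x, y)).
Proof.
have iF : m1.-integrable A (fubini_F m2 fA).
  by apply: integrableS (integrable_fubini_F fAi).
transitivity (\int[m1]_(x in A) fine (fubini_F m2 fA x)).
  apply: eq_Rintegral => x; rewrite inE => Ax.
  exact: (congr1 fine (esym (F_in Ax))).
transitivity (\int[m2]_y fine (fubini_G m1 fA y)); last first.
  by apply: eq_Rintegral => y _; rewrite fG_r.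
rewrite !Rintegral_fine//; congr fine.
rewrite -[RHS](Fubini fAi) [LHS]integral_mkcond; apply: eq_integral => x _.
rewrite patchE; case: ifPn => // xA; apply/esym/integral0_eq => y _.
by rewrite /fA patchE ifN// notin_setE => -[Ax _]; rewrite notin_setE in xA.
Qed.

End restricted_fubini.

(** A last time is used if there is one; otherwise the rational times of [I] are cofinal, since a
    rational lies between any two times. Countability lets the null sets attached to the segments be
    merged into one. *)
Lemma time_exhaustion (R : realType) (I : left_closed_itv R) :
  exists b : nat -> time I, forall t :
    time I, exists n, time_val t <= time_val (b n).
Proof.
have [[m mP]|nomax] := pselect (exists m : time I, forall t :
  time I, time_val t <= time_val m).
  by exists (fun=> m) => t; exists 0%N.
have /choice[b bP] : forall n, exists b : time I, forall q : rat, forall s :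
  time I,
    unpickle n = Some q -> time_val s = ratr q -> time_val b = ratr q.
  move=> n; case: (unpickle n) => [q|]; last by exists (time_min I).
  have [[s sq]|ns] := pselect (exists s : time I, time_val s = ratr q).
    by exists s => q' s' [<-].
  by exists (time_min I) => q' s [<-] sq; exfalso; apply: ns; exists s.
exists b => t.
have [t' tt'] : exists t' : time I, time_val t < time_val t'.
  apply: contrapT => nt; apply: nomax; exists t => s.
  by rewrite leNgt; apply/negP => ts; apply: nt; exists s.
have [q] := rat_in_itvoo tt'; rewrite in_itv/= => /andP[tq qt'].
have [s sq] : exists s : time I, time_val s = ratr q.
  by apply: (@time_between _ _ t t'); rewrite (ltW tq) (ltW qt').
by exists (pickle q); rewrite (bP _ q s)// ?pickleK// ltW.
Qed.

Section segment_integrable.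
Context {R : realType} {I : left_closed_itv R} d {T : measurableType d}.
Variable P : probability T R.
Implicit Types (h : time I * T -> R) (a b t : time I).
Local Notation leb := (lebesgue_time I).

(** Bounds are available on initial segments only, and may blow up towards the right end of [I]. *)
Definition segment_integrable h := forall b,
  (leb \x P)%E.-integrable (time_segment (time_min I) b `*` setT) (EFin \o h).

Let mS a b : measurable (time_segment a b `*` [set: T]).
Proof. by apply: measurableX => //; exact: time_segment_measurable. Qed.

Lemma segment_integrableS h a b : segment_integrable h ->
  (leb \x P)%E.-integrable (time_segment a b `*` setT) (EFin \o h).
Proof.
move=> /(_ b); apply: integrableS => // -[s u] [/andP[_ sb] _].
by split => //=; rewrite /time_segment/= time_min_le.
Qed.

Lemma segment_integrable_ae h : segment_integrable h ->
  {ae leb, forall t, P.-integrable setT (fun u => (h (t, u))%:E)}.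
Proof.
move=> hi; have [b bP] := time_exhaustion I.
have : {ae leb, forall t, forall n, time_segment (time_min I) (b n) t ->
    P.-integrable setT (fun u => (h (t, u))%:E)}.
  apply: ae_foralln => n.
  by apply: ae_integrable_section => //; exact: time_segment_measurable.
apply: filterS => t ht; have [n tn] := bP t; apply: (ht n).
by rewrite /time_segment/= time_min_le.
Qed.

Lemma segment_integrable_loc h : segment_integrable h ->
  loc_integrable (fun t => \int[P]_u h (t, u)).
Proof.
move=> hi K cK; have [b Kb] := compact_time_bounded cK.
apply: (@integrableS _ _ _ _ (time_segment (time_min I) b)) => //.
- exact: time_segment_measurable.
- exact: compact_time_measurable.
- by apply: integrable_Rintegral_section (hi b); exact: time_segment_measurable.
Qed.

Lemma segment_integrable_fubini h a b : segment_integrable h ->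
  \int[leb]_(s in time_segment a b) (\int[P]_u h (s, u)) =
  \int[P]_u (\int[leb]_(s in time_segment a b) h (s, u)).
Proof.
move=> hi; apply: Rintegral_fubini; first exact: time_segment_measurable.
exact: segment_integrableS.
Qed.

Lemma segment_integrable_section h a b : segment_integrable h ->
  P.-integrable setT (fun u => (\int[leb]_(s in time_segment a b) h (s, u))%:E).
Proof.
move=> hi; apply: (integrable_Rintegral_section_r (m1 := leb)).
  exact: time_segment_measurable.
exact: segment_integrableS.
Qed.

Lemma segment_integrable_sum k (h : 'I_k -> time I * T -> R) :
  (forall j, segment_integrable (h j)) ->
  segment_integrable (fun p => \sum_j h j p).
Proof.
move=> hi b; rewrite (_ : _ \o _ = fun p => (\sum_j (h j p)%:E)%E); last first.
  by apply/funext => p /=; rewrite sumEFin.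
by apply: integrable_sum => // j _; exact: hi.
Qed.

Lemma segment_integrable_bounded (c h : time I * T -> R) (M : R) :
  measurable_fun setT c -> (forall p, `|c p| <= M) -> segment_integrable h ->
  segment_integrable (fun p => c p * h p).
Proof.
move=> mc cM hi b; have := @integrableMr _ _ _ (leb \x P)%E _ (mS (time_min I)
  b)
  c (EFin \o h).
apply; [exact: measurable_funTS| |exact: hi].
exists M; split; first exact: num_real.
by move=> x Mx p _; exact: le_trans (cM p) (ltW Mx).
Qed.

Lemma segment_integrable_tonelli h : measurable_fun setT h ->
  (forall b, (\int[P]_u \int[leb]_(s in time_segment (time_min I) b)
     `|h (s, u)|%:E < +oo)%E) ->
  segment_integrable h.
Proof.
move=> mh hoo b; have mS' := mS (time_min I) b.
rewrite integrable_mkcond//.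
have mhS : measurable_fun setT ((EFin \o h) \_ (time_segment (time_min I) b `*`
  [set: T])).
  apply/(measurable_restrictT _ _).1 => //; apply/measurable_funTS.
  exact/measurable_EFinP.
apply/(integrable21ltyP leb P mhS); apply: le_lt_trans (hoo b).
rewrite le_eqVlt; apply/orP; left; apply/eqP; apply: eq_integral => u _.
rewrite [RHS]integral_mkcond; apply: eq_integral => s _.
rewrite !patchE; have [sb|sb] := boolP (s \in time_segment (time_min I) b).
  by rewrite mem_set//; split => //; rewrite inE in sb.
by rewrite memNset ?abse0// => -[sb' _]; rewrite notin_setE in sb.
Qed.

End segment_integrable.

(** Dominated convergence handles sequences only, which is enough as neighbourhoods of a time are
    given by real distances: a discontinuity at [t] would show along times within 1/(n+1) of [t]. *)
Lemma continuous_integral_paths (R : realType) (I : left_closed_itv R)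
    (X : ptopologicalType) (P : probability (borel (paths I X)) R) (phi :
      X -> R) :
  continuous phi -> (exists M, forall x, `|phi x| <= M) ->
  continuous (fun t : time I => \int[P]_u phi (eval_at t u)).
Proof.
move=> cphi [M phiM] t.
pose f (s : time I) := \int[P]_u phi (eval_at s u).
have mphi (s : time I) : measurable_fun setT
    (fun u : borel (paths I X) => phi (eval_at s u)).
  apply: measurable_fun_open => G oG; apply: sub_sigma_algebra.
  apply: (@open_comp _ _ (phi \o @eval_at R I X s)) => // u _.
  by apply: continuous_comp; [exact: eval_at_continuous|exact: cphi].
apply/cvgrPdist_lt; first exact: (nbhs_filter t).
move=> e e0; apply/nbhs_timeP; apply: contrapT => ne.
have /choice[s sP] : forall n : nat, exists s : time I,
    `|time_val s - time_val t| < n.+1%:R^-1 /\ e <= `|f t - f s|.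
  move=> n; apply: contrapT => ns; apply: ne; exists n.+1%:R^-1.
    by rewrite invr_gt0 ltr0n.
  by move=> s hs; rewrite ltNge; apply/negP => fs; apply: ns; exists s.
have st : s @ \oo --> t.
  move=> A /nbhs_timeP[d d0 dA].
  have := @cvg_harmonic R; move=> /cvgrPdist_lt/(_ _ d0); apply: filterS => n.
  rewrite sub0r normrN gtr0_norm ?invr_gt0 ?ltr0n// => nd.
  by apply: dA; apply: lt_trans nd; have [] := sP n.
have : (fun n => f (s n)) @ \oo --> f t.
  apply: (@Rintegral_dominated_cvg _ _ _ P setT
    (fun n u => phi (eval_at (s n) u)) (fun u => phi (eval_at t u)) (fun=> M)).
  - exact: measurableT.
  - by move=> n; exact: mphi.
  - exact: mphi.
  - apply: aeW => u _.
    have cu : continuous (u : time I -> X) by exact: cts_fun.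
    have us : (fun n => (u : time I -> X) (s n)) @ \oo --> (u : time I -> X) t.
      exact: (cvg_comp s (u : time I -> X) st (cu t)).
    exact: (cvg_comp _ phi us (cphi _)).
  - exact: finite_measure_integrable_cst.
  - by move=> n u _; exact: phiM.
move=> /cvgrPdist_lt/(_ _ e0)[N _ /(_ N (leqnn N))/=].
by have [_] := sP N; rewrite leNgt => /negbTE ->.
Qed.

(** * Statistical solutions *)

Section C1c_bounded.
Context {R : realType} {k : nat} (phi : 'rV[R]_k -> R).
Hypothesis phiC : C1c phi.

Lemma continuous_compact_support_bounded (f : 'rV[R]_k -> R) :
  continuous f -> (forall x, ~ closure [set x | phi x != 0] x -> f x = 0) ->
  exists M, forall x, `|f x| <= M.
Proof.
move=> cf f0; have [_ _ cS] := phiC.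
have : compact (f @` closure [set x | phi x != 0]).
  by apply: continuous_compact => //; exact: continuous_subspaceT.
move=> /compact_bounded[M [Mr HM]]; exists (`|M| + 1) => x.
have [Sx|/f0->] := pselect (closure [set x | phi x != 0] x); last first.
  by rewrite normr0 addr_ge0.
apply: (HM (`|M| + 1)); last by exists x.
by rewrite (le_lt_trans (ler_norm _))// ltrDl.
Qed.

Lemma C1c_continuous : continuous phi.
Proof. by move=> x; apply: differentiable_continuous; have [d _ _] := phiC. Qed.

Lemma C1c_bounded : exists M, forall x, `|phi x| <= M.
Proof.
apply: (continuous_compact_support_bounded C1c_continuous) => x nx.
by apply/eqP; apply: contrapT => /negP phix; apply: nx; exact: subset_closure.
Qed.

Lemma C1c_derive_bounded h : exists M, forall x, `|'D_h phi x| <= M.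
Proof.
have [_ cD _] := phiC; apply: (continuous_compact_support_bounded (cD h)) =>
  x nx.
rewrite -(derive_cst (0 : R) x h); apply: near_eq_derive.
have : nbhs x (~` closure [set x | phi x != 0]).
  by apply: open_nbhs_nbhs; split => //; exact/closed_openC/closed_closure.
apply: filterS => y ny; apply/eqP; apply: contrapT => /negP phiy.
by apply: ny; exact: subset_closure.
Qed.

End C1c_bounded.

Lemma pushforward_probability d d' (T : measurableType d) (T' :
  measurableType d')
    (R : realType) (P : probability T R) (f : T -> T') :
      measurable_fun setT f ->
  exists Q : probability T' R, forall A, Q A = P (f @^-1` A).
Proof.
move=> mf.
pose f' : {mfun T >-> T'} := HB.pack f (isMeasurableFun.Build _ _ _ _ f mf).
by exists (distribution P f').
Qed.

Section image_measure.
Context d d' (T : measurableType d) (T' : measurableType d') (R : realType).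
Variables (P : probability T R) (f : T -> T') (Q : probability T' R).
Hypotheses (mf : measurable_fun setT f)
  (QE : forall A, measurable A -> Q A = P (f @^-1` A)).

Lemma ge0_integral_image (h : T' -> \bar R) : measurable_fun setT h ->
  (forall x, 0 <= h x)%E -> (\int[Q]_x h x = \int[P]_x h (f x))%E.
Proof.
move=> mh h0.
rewrite (@eq_measure_integral _ _ _ _ (pushforward P f)); last first.
  by move=> A mA _; exact: QE.
by rewrite ge0_integral_pushforward.
Qed.

Lemma integral_image (h : T' -> \bar R) : measurable_fun setT h ->
  (\int[Q]_x h x = \int[P]_x h (f x))%E.
Proof.
move=> mh; rewrite -[RHS]/(\int[P]_x (h \o f) x)%E integralE [RHS]integralE.
rewrite (funepos_comp h f) (funeneg_comp h f); congr (_ - _)%E.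
- exact: (ge0_integral_image (measurable_funepos mh) (funepos_ge0 h)).
- exact: (ge0_integral_image (measurable_funeneg mh) (funeneg_ge0 h)).
Qed.

Lemma integrable_image (h : T' -> \bar R) : measurable_fun setT h ->
  P.-integrable setT (h \o f) -> Q.-integrable setT h.
Proof.
move=> mh /integrableP[_ hoo]; apply/integrableP; split => //.
by rewrite ge0_integral_image//; exact: measurableT_comp.
Qed.

End image_measure.

(** * The evolution equation along the trajectories *)

Section evolution.
Context {R : realType} {X Z : ptopologicalType} {Y : topologicalLmodType R}
  {I : left_closed_itv R}.
Variables (iZX : Z -> X) (iXY : X -> weak_star Y) (F : time I * Z -> topdual Y).
Hypotheses (iZX_inj : injective iZX) (iXY_cont : continuous iXY).
Hypothesis H4 : forall B : set (borel Z), measurable B ->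
  measurable (iZX @` B : set (borel X)).
Hypothesis H5_meas : measurable_fun setT
  (F : time I * borel Z -> borel (strong_dual Y)).
Variables (U : set (paths I X)) (P : probability (borel (paths I X)) R).
Hypothesis PU : {ae P, forall u, U u}.
Hypothesis H5_X1 : U `<=` X1 iZX iXY.
Hypothesis H5_int : forall u, U u -> forall v : Y,
  loc_integrable (fun t => pairF iZX F t (u t) v).
Hypothesis H5_eq : forall u, U u -> forall v : Y,
  distr_derivative (fun t => (iXY (u t) : topdual Y) v)
                   (fun t => pairF iZX F t (u t) v).
Local Notation leb := (lebesgue_time I).
Local Notation t0 := (time_min I).

Definition path_pairF (v : Y) (p : time I * borel (paths I X)) : R :=
  pairF iZX F p.1 (eval_pair p) v.

Lemma path_pairF_measurable v : measurable_fun setT (path_pairF v).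
Proof.
have mg : measurable_fun setT
    (fun p : time I * borel (paths I X) =>
      (p.1, eval_pair p) : time I * borel X).
  by apply: measurable_fun_pair;
    [exact: measurable_fst|exact: eval_pair_measurable].
exact: (measurableT_comp (pairF_measurable iZX_inj H4 H5_meas v) mg).
Qed.

Lemma pairF_section_measurable t v :
  measurable_fun setT (fun x : borel X => pairF iZX F t x v).
Proof.
exact: (measurableT_comp (pairF_measurable iZX_inj H4 H5_meas v)
  (pair1_measurable t)).
Qed.

Lemma weak_star_continuous v : continuous (fun x => (iXY x : topdual Y) v).
Proof.
move=> x; apply: (@continuous_comp X (weak_star Y) R iXY
  (fun f => (f : topdual Y) v)); first exact: iXY_cont.
exact: weak_star_eval_continuous.
Qed.

Lemma coords_continuous k (v : 'I_k -> Y) :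
  continuous (fun x => coords v (iXY x)).
Proof.
apply: continuous_row => j.
rewrite (_ : (fun x => _) = fun x => (iXY x : topdual Y) (v j)).
  exact: weak_star_continuous.
by apply/funext => x; rewrite mxE.
Qed.

Lemma pairF_sum t x k (a : 'I_k -> R) (v : 'I_k -> Y) :
  pairF iZX F t x (\sum_j a j *: v j) = \sum_j a j * pairF iZX F t x (v j).
Proof.
have [[z _ <-]|nx] := pselect (inZ iZX x).
  rewrite pairF_in// linear_sum; apply: eq_bigr => j _.
  by rewrite pairF_in// linearZ.
by rewrite pairF_out// big1// => j _; rewrite pairF_out// mulr0.
Qed.

(** Two quantifiers are exchanged: almost every path is in [Z] at almost every time. By Tonelli's
    theorem for the indicator of the exceptional pairs, at almost every time almost every path is in
    [Z]. *)
Lemma ae_carried_inZ : {ae leb, forall t,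
  P (eval_at t @^-1` (~` inZ iZX)) = 0%E}.
Proof.
pose N := [set p : time I * borel (paths I X) | ~ inZ iZX (eval_pair p)].
have mN : measurable N.
  have := @eval_pair_measurable R I X measurableT (~` inZ iZX).
  by rewrite setTI; apply; apply: measurableC; exact: inZ_measurable.
have m1 : measurable_fun setT (EFin \o \1_N :
  time I * borel (paths I X) -> \bar R).
  by apply/measurable_EFinP; exact: measurable_indic.
have m0 p : (0 <= (EFin \o \1_N : time I * borel (paths I X) -> \bar R) p)%E.
  by rewrite lee_fin.
have := fubini_tonelli (m1 := leb) (m2 := P) (EFin \o \1_N) m1 (fun p => m0 p).
have -> : (\int[P]_u \int[leb]_t (EFin \o \1_N) (t, u) = 0)%E.
  rewrite -[RHS](integral0 P setT).
  apply: ae_eq_integral; [exact: measurableT| |exact: measurable_cst|].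
    exact: (measurable_fun_fubini_tonelli_G (m1 := leb) (EFin \o \1_N) m1 m0).
  apply: (@filterS _ _ (ae_filter_ringOfSetsType P) U _ _ PU) => u Uu _.
  have [uZ _] := H5_X1 Uu.
  rewrite -[RHS](integral0 leb setT).
  apply: ae_eq_integral; [exact: measurableT| |exact: measurable_cst|].
    exact: measurableT_comp m1 (pair2_measurable u).
  by apply: filterS uZ => t utZ _; rewrite /= indicE memNset.
move=> h.
pose G t := (\int[P]_u (EFin \o \1_N) (t, u))%E.
have mG : measurable_fun setT G.
  exact: (measurable_fun_fubini_tonelli_F (m2 := P) (EFin \o \1_N) m1 m0).
have := (ae_eq_integral_abs leb measurableT mG).1 _.
have -> : (\int[leb]_t `|G t|)%E = 0%E.
  rewrite -h; apply: eq_integral => t _; rewrite gee0_abs//.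
  by apply: integral_ge0 => u _; exact: m0.
move=> /(_ erefl); apply: filterS => t /(_ Logic.I) Gt0.
transitivity (G t); [rewrite /G|exact: Gt0].
have -> : (fun u => (EFin \o \1_N) (t, u)) = (fun u : borel (paths I X) =>
    (\1_(eval_at t @^-1` (~` inZ iZX)) u)%:E :> \bar R).
  by apply/funext => u; rewrite /= !indicE.
rewrite integral_indic// ?setIT//.
rewrite -[X in measurable X]setTI.
apply: continuous_borel => //; first exact: eval_at_continuous.
by apply: measurableC; exact: inZ_measurable.
Qed.

Lemma trajectory_integral u v a b : U u -> time_val a <= time_val b ->
  (iXY (u b) : topdual Y) v - (iXY (u a) : topdual Y) v =
  \int[leb]_(s in time_segment a b) pairF iZX F s (u s) v.
Proof.
move=> Uu ab.
apply: (@distr_derivative_integral _ _ (fun t =>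
  (iXY (u t) : topdual Y) v)) => //.
- move=> t; apply: (continuous_comp (f := (u : time I -> X))
    (g := fun x => (iXY x : topdual Y) v)); first exact: cts_fun.
  exact: weak_star_continuous.
- exact: H5_int.
- exact: H5_eq.
Qed.

Lemma derive_coords_measurable k (phi : 'rV[R]_k -> R) (v : 'I_k -> Y) j :
  C1c phi -> measurable_fun setT
    (fun x : borel X => 'D_(delta_mx 0 j) phi (coords v (iXY x))).
Proof.
move=> [_ cD _]; apply: measurable_fun_open => G oG; apply: sub_sigma_algebra.
apply: (@open_comp X R (fun x =>
  'D_(delta_mx 0 j) phi (coords v (iXY x)))) => // x _.
exact: (continuous_comp (@coords_continuous _ v x) (cD _ _)).
Qed.

Lemma cylinder_section_measurable t k (phi : 'rV[R]_k -> R) (v : 'I_k -> Y) :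
  C1c phi -> measurable_fun setT
    (fun x : borel X => pairF iZX F t x (cylinder' phi v (iXY x))).
Proof.
move=> phiC.
rewrite (_ : (fun x => _) = fun x : borel X => \sum_j
    'D_(delta_mx 0 j) phi (coords v (iXY x)) * pairF iZX F t x (v j)).
  apply: measurable_sum => j; apply: measurable_funM.
    exact: derive_coords_measurable.
  exact: pairF_section_measurable.
by apply/funext => x; exact: pairF_sum.
Qed.

Lemma cylinder_continuous k (phi : 'rV[R]_k -> R) (v : 'I_k -> Y) :
  C1c phi -> continuous (fun x => cylinder phi v (iXY x)).
Proof.
move=> phiC x; apply: (@continuous_comp X 'rV[R]_k R (fun x =>
  coords v (iXY x)) phi).
  exact: coords_continuous.
exact: C1c_continuous.
Qed.

Section energy.
Hypothesis Fint : forall v, segment_integrable P (path_pairF v).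

Definition path_cylinder k (phi : 'rV[R]_k -> R) (v : 'I_k -> Y)
    (p : time I * borel (paths I X)) : R :=
  pairF iZX F p.1 (eval_pair p) (cylinder' phi v (iXY (eval_pair p))).

Lemma path_cylinderE k (phi : 'rV[R]_k -> R) (v : 'I_k -> Y) p :
  path_cylinder phi v p = \sum_j 'D_(delta_mx 0 j) phi (coords v (iXY
    (eval_pair p))) *
    path_pairF (v j) p.
Proof. exact: pairF_sum. Qed.

Lemma path_cylinder_integrable k (phi : 'rV[R]_k -> R) (v : 'I_k -> Y) :
  C1c phi -> segment_integrable P (path_cylinder phi v).
Proof.
move=> phiC; have [_ cD _] := phiC.
have -> : path_cylinder phi v = fun p => \sum_j
    'D_(delta_mx 0 j) phi (coords v (iXY (eval_pair p))) * path_pairF (v j) p.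
  by apply/funext => p; exact: path_cylinderE.
apply: segment_integrable_sum => j.
have [M DM] := C1c_derive_bounded phiC (delta_mx 0 j).
apply: (@segment_integrable_bounded _ _ _ _ _ _ _ M) => //.
have mD := derive_coords_measurable v j phiC.
exact: (measurableT_comp mD (@eval_pair_measurable R I X)).
Qed.

Lemma path_cylinder_evolution k (phi : 'rV[R]_k -> R) (v : 'I_k -> Y) u a b :
  C1c phi -> U u -> time_val a <= time_val b ->
  cylinder phi v (iXY (eval_at b u)) - cylinder phi v (iXY (eval_at a u)) =
  \int[leb]_(s in time_segment a b) path_cylinder phi v (s, u).
Proof.
move=> [dphi cD _] Uu ab.
have [|||||_ H] := @chain_rule_integral R I k phi
  (fun j t => (iXY (u t) : topdual Y) (v j)) (fun j t =>
    pairF iZX F t (u t) (v j)) a b dphi.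
- by move=> j; exact: cD.
- move=> j t; apply: (continuous_comp (f := (u : time I -> X))
    (g := fun x => (iXY x : topdual Y) (v j))); first exact: cts_fun.
  exact: weak_star_continuous.
- by move=> j; exact: H5_int.
- by move=> j s t st; exact: trajectory_integral.
- exact: ab.
rewrite /cylinder /coords H; apply: eq_Rintegral => s _.
by rewrite path_cylinderE.
Qed.

End energy.
End evolution.

(* Almost every t is as good as every t, except at a right end point of I, where
   [mu0_gamma_max] takes over. *)
Lemma late_time (R : realType) (I : left_closed_itv R) (Q : time I -> Prop) :
  {ae lebesgue_time I, forall t, Q t} ->
  (forall t : time I, time_val (time_min I) < time_val t ->
    (forall s : time I, time_val s <= time_val t) -> Q t) ->
  forall b : time I, time_val b = time_val (time_min I) \/
    exists2 t, time_val b <= time_val t & Q t.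
Proof.
move=> aeQ Qmax b.
have [[b' bb']|nb] := pselect (exists b' : time I, time_val b < time_val b').
  right; apply: contrapT => nt.
  (* Otherwise [Q] would fail on a whole segment of positive length, which is not null. *)
  have sub : time_segment b b' `<=` ~` Q.
    move=> t /andP[bt _] Qt; apply: nt; exists t => //.
  have neg : (lebesgue_time I).-negligible (time_segment b b').
    exact: negligibleS sub aeQ.
  have : lebesgue_time I (time_segment b b') = 0%E.
    exact: (negligibleP _ (@time_segment_measurable R I b b')).1 neg.
  move=> /eqP; rewrite lebesgue_time_segment ?(ltW bb')// eqe subr_eq0 =>
    /eqP bE.
  by move: bb'; rewrite bE ltxx.
have bmax (s : time I) : time_val s <= time_val b.
  by rewrite leNgt; apply/negP => bs; apply: nb; exists s.
have [->|b0] := eqVneq (time_val b) (time_val (time_min I)); first by left.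
by right; exists b => //; apply: Qmax => //;
  rewrite lt_neqAle eq_sym b0 time_min_le.
Qed.

(** * Integrability of the vector field along random trajectories *)

Section energy_bound.
Context {R : realType} {X Z : ptopologicalType} {Y : topologicalLmodType R}
  {I : left_closed_itv R}.
Variables (iZX : Z -> X) (F : time I * Z -> topdual Y).
Hypotheses (iZX_inj : injective iZX).
Hypothesis H4 : forall B : set (borel Z), measurable B ->
  measurable (iZX @` B : set (borel X)).
Hypothesis H5_meas : measurable_fun setT
  (F : time I * borel Z -> borel (strong_dual Y)).
Variables (U : set (paths I X)) (X0 : set (borel X))
  (P : probability (borel (paths I X)) R) (mu0 : probability (borel X) R).
Hypothesis PU : {ae P, forall u, U u}.
Hypothesis Pmu0 : forall A : set (borel X), measurable A ->
  P (eval_at (time_min I) @^-1` A) = mu0 A.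
Hypothesis H1' : X0 `<=` eval_at (time_min I) @` U.
Hypothesis mu0_X0 : carried_by mu0 X0.
Hypothesis H5_int : forall u, U u -> forall v : Y,
  loc_integrable (fun t => pairF iZX F t (u t) v).
Variables (gamma : time I -> X -> Y -> R).
Hypothesis H6_meas : forall v : Y, measurable_fun setT
  (fun p : time I * borel X => gamma p.1 p.2 v).
Hypothesis H6_bound : forall (v : Y) (t : time I) (u : paths I X), U u ->
  (\int[lebesgue_time I]_(s in time_segment (time_min I) t)
     `|pairF iZX F s (u s) v|%:E
   <= (gamma t (u (time_min I)) v)%:E)%E.
Local Notation leb := (lebesgue_time I).
Local Notation t0 := (time_min I).

Let G v (b : time I) u := (\int[leb]_(s in time_segment t0 b)
  `|pairF iZX F s (eval_at s u) v|%:E)%E.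

Let G_ge0 v b u : (0 <= G v b u)%E.
Proof. by apply: integral_ge0 => s _; rewrite lee_fin. Qed.

Let mG v b : measurable_fun setT (G v b : borel (paths I X) -> \bar R).
Proof.
pose f := (fun p : time I * borel (paths I X) =>
  (`|path_pairF iZX F v p| * \1_(time_segment t0 b) p.1)%:E).
have mf : measurable_fun setT f.
  apply/measurable_EFinP; apply: measurable_funM.
    apply: measurableT_comp; first exact: normr_measurable.
    exact: path_pairF_measurable.
  apply: (measurableT_comp (f := \1_(time_segment t0 b) : time I -> R)).
    by apply: measurable_indic; exact: time_segment_measurable.
  exact: measurable_fst.
have f0 p : (0 <= f p)%E by rewrite lee_fin mulr_ge0.
have := measurable_fun_fubini_tonelli_G (m1 := leb) f mf f0.
apply: eq_measurable_fun => u _; rewrite /fubini_G /G [RHS]integral_mkcond.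
apply: eq_integral => s _; rewrite patchE /f /= indicE.
by case: (s \in _); rewrite ?mulr1// mulr0.
Qed.

Let gamma_measurable t v : measurable_fun setT
  (fun x : borel X => (gamma t x v)%:E).
Proof.
apply/measurable_EFinP.
exact: (measurableT_comp (H6_meas v) (pair1_measurable t)).
Qed.

(** By [H1'] a trajectory of [U] starts at [x], and [gamma] bounds an integral of a nonnegative
    function along it. Outside [X0] the sign of [gamma] is unknown. *)
Let gamma_ge0 t v x : X0 x -> 0 <= gamma t x v.
Proof.
move=> /H1'[u Uu <-]; rewrite -lee_fin (le_trans _ (H6_bound v t Uu))//.
by apply: integral_ge0 => s _; rewrite lee_fin.
Qed.

Lemma path_pairF_integrable v :
  {ae leb, forall t, (\int[mu0]_x (gamma t x v)%:E < +oo)%E} ->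
  (forall t : time I, time_val t0 < time_val t ->
     (forall s : time I, time_val s <= time_val t) ->
     (\int[mu0]_x (gamma t x v)%:E < +oo)%E) ->
  segment_integrable P (path_pairF iZX F v).
Proof.
move=> gae gmax; apply: segment_integrable_tonelli.
  exact: path_pairF_measurable.
move=> b; rewrite -[X in (X < _)%E]/(\int[P]_u G v b u)%E.
(* Either the segment is a point and the integral vanishes, or it is enlarged to end at a time [t]
   at which [gamma] has an integral below infinity. *)
have [b0|[t bt goo]] := late_time gae gmax b.
  rewrite (_ : (\int[P]_u _)%E = 0%E) ?ltry//.
  rewrite -[RHS](integral0 P setT); apply: ae_eq_integral.
  - exact: measurableT.
  - exact: mG.
  - exact: measurable_cst.
  apply: (@filterS _ _ (ae_filter_ringOfSetsType P) U _ _ PU) => u Uu _.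
  apply: null_set_integral.
  - exact: time_segment_measurable.
  - have := measurable_int _ (loc_integrable_segment t0 b (loc_integrable_norm
      (H5_int Uu v))).
    by [].
  - have h : lebesgue_time I (time_segment t0 b) = 0%E.
      by rewrite lebesgue_time_segment b0// subrr.
    exact: h.
have mGp := measurable_funepos (gamma_measurable t v).
(* The positive part stands in for [gamma], which may be negative outside [X0]. It makes the change
   of variables for nonnegative functions applicable, and agrees with [gamma] almost everywhere for
   [mu0]. *)
apply: (@le_lt_trans _ _ (\int[P]_u ((fun x =>
  (gamma t x v)%:E)^\+ (eval_at t0 u)))%E).
  apply: ae_ge0_le_integral.
  - exact: measurableT.
  - by move=> u _; exact: G_ge0.
  - exact: mG.
  - by move=> u _; exact: funepos_ge0.
  - apply: (measurableT_comp mGp); apply: continuous_borel.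
    exact: eval_at_continuous.
  apply: (@filterS _ _ (ae_filter_ringOfSetsType P) U _ _ PU) => u Uu _.
  apply: (@le_trans _ _ (G v t u)).
    apply: ge0_subset_integral.
    - exact: time_segment_measurable.
    - exact: time_segment_measurable.
    - exact: measurable_int (loc_integrable_segment t0 t (loc_integrable_norm
        (H5_int Uu v))).
    - by move=> s _; rewrite lee_fin.
    - by move=> s /andP[t0s sb]; rewrite /time_segment/= t0s (le_trans sb bt).
  apply: (le_trans (H6_bound v t Uu)).
  by rewrite funeposE le_max lexx.
have mev : measurable_fun setT (eval_at t0 : borel (paths I X) -> borel X).
  by apply: continuous_borel; exact: eval_at_continuous.
have QE (A : set (borel X)) : measurable A ->
    mu0 A = P ((eval_at t0 : borel (paths I X) -> borel X) @^-1` A).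
  by move=> mA; rewrite -Pmu0.
have imE := ge0_integral_image mev QE mGp (funepos_ge0 _).
apply: (@le_lt_trans _ _ (\int[mu0]_x (fun x => (gamma t x v)%:E)^\+ x)%E).
  by rewrite imE.
rewrite (_ : (\int[mu0]_x _)%E = (\int[mu0]_x (gamma t x v)%:E)%E)//.
apply: ae_eq_integral.
- exact: measurableT.
- exact: mGp.
- exact: gamma_measurable.
have [mX0 muX0] := mu0_X0.
exists (~` X0); split; [exact: measurableC|exact: muX0|].
move=> x /= nx X0x; apply: nx => _; rewrite funeposE.
by apply/max_idPl; rewrite lee_fin gamma_ge0.
Qed.

End energy_bound.

Theorem theorem3p5 (R : realType) (X Z : ptopologicalType)
  (Y : topologicalLmodType R)
  (hX : hausdorff_space X) (hZ : hausdorff_space Z)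
  (iZX : Z -> X) (iZX_inj : injective iZX) (iZX_cont : continuous iZX)
  (iXY : X -> weak_star Y) (iXY_inj : injective iXY) (iXY_cont : continuous iXY)
  (I : left_closed_itv R)
  (U : set (paths I X))
  (X0 : set (borel X)) (X0_borel : measurable X0)
  (H1' : X0 `<=` eval_at (time_min I) @` U)
  (KK : set (set X)) (KK_compact : forall K, KK K -> compact K /\ K `<=` X0)
  (H2' : forall mu : probability (borel X) R,
     tight mu -> carried_by mu X0 -> inner_regular mu KK)
  (H3' : forall K, KK K -> compact (eval_at (time_min I) @^-1` K `&` U))
  (H4 : forall B : set (borel Z), measurable B ->
     measurable (iZX @` B : set (borel X)))
  (F : time I * Z -> topdual Y)
  (H5_X1 : U `<=` X1 iZX iXY)
  (H5_meas : measurable_fun setT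
     (F : time I * borel Z -> borel (strong_dual Y)))
  (H5_int : forall u, U u -> forall v : Y,
     loc_integrable (fun t => pairF iZX F t (u t) v))
  (H5_eq : forall u, U u -> forall v : Y,
     distr_derivative (fun t => (iXY (u t) : topdual Y) v)
                      (fun t => pairF iZX F t (u t) v))
  (gamma : time I -> X -> Y -> R)
  (H6_meas : forall v : Y, measurable_fun setT
     (fun p : time I * borel X => gamma p.1 p.2 v))
  (H6_bound : forall (v : Y) (t : time I) (u : paths I X), U u ->
     (\int[lebesgue_time I]_(s in time_segment (time_min I) t)
        `|pairF iZX F s (u s) v|%:E
      <= (gamma t (u (time_min I)) v)%:E)%E)
  (mu0 : probability (borel X) R) (mu0_tight : tight mu0)
  (mu0_X0 : carried_by mu0 X0)
  (mu0_gamma : forall v : Y, \forall t \ae lebesgue_time I,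
     (\int[mu0]_x (gamma t x v)%:E < +oo)%E)
  (* only constrains intervals that contain their right end point; without it
     the theorem fails on [t0, t1] *)
  (mu0_gamma_max : forall t : time I, time_val (time_min I) < time_val t ->
     (forall s : time I, time_val s <= time_val t) ->
     forall v : Y, (\int[mu0]_x (gamma t x v)%:E < +oo)%E) :
  exists rho : time I -> probability (borel X) R,
    projected_statistical_solution iZX iXY F U rho /\
    forall A : set (borel X), measurable A -> rho (time_min I) A = mu0 A.
Proof.
have [P [tP [V [mV VU PV]] Pmu0]] :=
  tight_lifting (@paths_hausdorff R I X hX) hX
  (@eval_at_continuous R I X (time_min I)) H1' KK_compact
  (H2' mu0 mu0_tight mu0_X0) H3'.
have PU : {ae P, forall u, U u}.
  exists (~` V); split; [exact: measurableC|exact: PV|].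
  by move=> u /= nU Vu; apply: nU; exact: VU.
have mev (t : time I) :
    measurable_fun setT (eval_at t : borel (paths I X) -> borel X).
  by apply: continuous_borel; exact: eval_at_continuous.
have /choice[rho rhoE] : forall t : time I, exists Q : probability (borel X) R,
    forall A, Q A = P ((eval_at t : borel (paths I X) -> borel X) @^-1` A).
  by move=> t; exact: pushforward_probability (mev t).
have rhoE' t A : measurable A -> rho t A =
    P ((eval_at t : borel (paths I X) -> borel X) @^-1` A) by move=> _;
      exact: rhoE.
have Fint v : segment_integrable P (path_pairF iZX F v).
  have h := @path_pairF_integrable _ _ _ _ _ iZX F iZX_inj H4 H5_meas U X0 P
    mu0 PU Pmu0 H1'
    mu0_X0 H5_int gamma H6_meas H6_bound v.
  apply: h; first exact: mu0_gamma.
  by move=> t t0t tmax; exact: mu0_gamma_max.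
have rhoI t (h : X -> R) : measurable_fun setT (h : borel X -> R) ->
    \int[rho t]_x h x = \int[P]_u h (eval_at t u).
  move=> mh; congr fine; apply: (integral_image (mev t) (rhoE' t)).
  exact/measurable_EFinP.
have mcont (h : X -> R) : continuous h -> measurable_fun setT (h :
  borel X -> R).
  move=> ch; apply: measurable_fun_open => G oG; apply: sub_sigma_algebra.
  by apply: open_comp => // x _; exact: ch.
exists rho; split; last by move=> A mA; rewrite rhoE Pmu0.
split; last by exists P; split; [split=> //; exists V|move=> t A _;
  exact: rhoE].
split.
- move=> phi cphi bphi.
  rewrite (_ : (fun t => _) = fun t => \int[P]_u phi (eval_at t u)).
    exact: continuous_integral_paths.
  by apply/funext => t; apply: rhoI; exact: mcont.
- move=> v; have mpair t := pairF_section_measurable iZX_inj H4 H5_meas t v.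
  split.
    have aeZ := ae_carried_inZ H4 PU H5_X1.
    have aeI := segment_integrable_ae (Fint v).
    apply: filterS2 aeZ aeI => t tZ tI; split.
      by split; [exact: inZ_measurable|rewrite rhoE].
    apply: (integrable_image (mev t) (rhoE' t)); last exact: tI.
    exact/measurable_EFinP.
  rewrite (_ : (fun t => _) = fun t => \int[P]_u path_pairF iZX F v (t, u)).
    exact: segment_integrable_loc.
  by apply/funext => t; exact: rhoI.
move=> k phi v phiC.
have hi := path_cylinder_integrable iZX_inj iXY_cont Fint v phiC.
have mcyl t : measurable_fun setT
    (fun x : borel X => pairF iZX F t x (cylinder' phi v (iXY x))).
  exact: cylinder_section_measurable.
have rhocyl t : \int[rho t]_x pairF iZX F t x (cylinder' phi v (iXY x)) =
    \int[P]_u path_cylinder iZX iXY F phi v (t, u) by exact: rhoI.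
split.
  rewrite (_ : (fun t => _) = fun t =>
    \int[P]_u path_cylinder iZX iXY F phi v (t, u)).
    exact: segment_integrable_loc.
  by apply/funext.
(* Times in increasing order suffice: the sign convention of [time_integral] takes care of the other
   order. *)
have evol (a b : time I) : time_val a <= time_val b ->
    \int[rho b]_x cylinder phi v (iXY x) - \int[rho a]_x cylinder phi v (iXY x)
      =
    \int[lebesgue_time I]_(s in time_segment a b)
       \int[rho s]_x pairF iZX F s x (cylinder' phi v (iXY x)).
  move=> ab; have [M phiM] := C1c_bounded phiC.
  have ccyl := cylinder_continuous iXY_cont phiC (v := v).
  have mcylP t : measurable_fun setT
      (fun u : borel (paths I X) => cylinder phi v (iXY (eval_at t u))).
    exact: (measurableT_comp (mcont _ ccyl) (mev t)).
  have icyl t : P.-integrable setT (EFin \o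
      (fun u : borel (paths I X) => cylinder phi v (iXY (eval_at t u)))).
    apply: le_integrable (finite_measure_integrable_cst P M measurableT) => //.
      exact/measurable_EFinP.
    by move=> u _; rewrite lee_fin /= (le_trans (phiM _))// ler_norm.
  rewrite !(rhoI _ _ (mcont _ ccyl)) -RintegralB//.
  transitivity (\int[P]_u \int[lebesgue_time I]_(s in time_segment a b)
      path_cylinder iZX iXY F phi v (s, u)).
    congr fine; apply: ae_eq_integral.
    - exact: measurableT.
    - by apply/measurable_EFinP; exact: measurable_funB.
    - exact: measurable_int (segment_integrable_section a b hi).
    (* The identity is known for paths of [U] only, which are almost all paths for [P]. *)
    apply: (@filterS _ _ (ae_filter_ringOfSetsType P) U _ _ PU) => u Uu _.
    congr EFin; exact: (path_cylinder_evolution iZX_inj iXY_cont H5_int H5_eq).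
  rewrite -segment_integrable_fubini//; apply: eq_Rintegral => s _.
  by rewrite rhocyl.
move=> t t'; rewrite /time_integral; case: leP => tt'.
  by rewrite -evol// addrC subrK.
by rewrite -evol ?(ltW tt')// opprB addrC subrK.
Qed.
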